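(* Let $e\in\mathbb{S}^n$ and let $\mathbb{S}_e^+$ be the closed halfsphere of $\mathbb{S}^n$ with center $e$. Then $$\lim_{\delta\to0^+}\frac{\mathrm{vol}_n^s(\mathbb{S}_e^+)-\mathrm{vol}_n^s((\mathbb{S}_e^+)_\delta^s)}{\delta}=\frac{2\pi\,\mathrm{vol}_{n-1}^s(\mathbb{S}^{n-1})}{\mathrm{vol}_n^s(\mathbb{S}^n)}=2\sqrt{\pi}\,\frac{\Gamma\left(\frac{n+1}{2}\right)}{\Gamma\left(\frac n2\right)},$$ where $(\mathbb{S}_e^+)_\delta^s$ is the spherical floating body of $\mathbb{S}_e^+$.
   Context: $\mathbb{S}^n$ is the Euclidean unit sphere in $\mathbb{R}^{n+1}$, $n\ge1$, and $\mathrm{vol}_k^s$ is the spherical Lebesgue measure on $\mathbb{S}^k$. The closed halfsphere with center $e$ is $\mathbb{S}_e^+=\{v\in\mathbb{S}^n:v\cdot e\ge0\}$. For a great hypersphere $H$ of $\mathbb{S}^n$, $H^\pm$ are the two closed halfspheres bounded by $H$ (in either order). For $P\subset\mathbb{S}^n$ a spherical polytope with nonempty interior (including closed halfspheres) and small $\delta>0$, the spherical floating body is $$P_\delta^s=\bigcap\{H^+\cap P:\mathrm{vol}_n^s(H^-\cap P)\le\delta\}.$$ *)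

(* Defs.v *)
From HB Require Import structures.
From mathcomp Require Import all_boot all_order all_algebra.
From mathcomp Require Import all_classical all_reals all_analysis.
Import Order.TTheory GRing.Theory Num.Theory.
Import numFieldNormedType.Exports.

Set Implicit Arguments.
Unset Strict Implicit.
Unset Printing Implicit Defensive.

Local Open Scope classical_set_scope.
Local Open Scope ring_scope.

Section spherical_geometry.
Variable R : realType.

Definition dotp n (u v : 'rV[R]_n) : R := \sum_(i < n) u 0 i * v 0 i.

(* The sphere is defined through [dotp] because the canonical norm `|v| of
   'rV[R]_n is the sup norm. *)
Definition sphere k : set 'rV[R]_k.+1 := [set v | dotp v v = 1].

Definition halfsphere k (e : 'rV[R]_k.+1) : set 'rV[R]_k.+1 :=
  [set v | sphere v /\ 0 <= dotp v e].

(* n-dimensional Lebesgue measure, as the n-fold product of the Lebesgue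
   measure of the line. It is a total set function, meaningful on Borel sets. *)
Fixpoint lebesgue_tuple n : set (n.-tuple (measurableTypeR R)) -> \bar R :=
  match n with
  | 0 => \d_[tuple]
  | m.+1 => pushforward (lebesgue_measure \x (@lebesgue_tuple m))%E
              (fun p => [tuple of p.1 :: p.2])
  end.

Definition lebesgue_rV n (A : set 'rV[R]_n) : \bar R :=
  lebesgue_tuple [set t : n.-tuple _ | A (\row_i tnth t i)].

Definition cone k (A : set 'rV[R]_k.+1) : set 'rV[R]_k.+1 :=
  [set w | exists t v, [/\ 0 <= t <= 1, A v & w = t *: v]].

(* Spherical Lebesgue measure on the unit sphere S^k of R^(k+1): k + 1 times the
   Lebesgue measure of the cone over A, so that vol(S^k) is the surface area:
   vol(S^1) = 2 pi, and vol is the counting measure on S^0. *)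
Definition svol k (A : set 'rV[R]_k.+1) : \bar R :=
  ((k.+1)%:R%:E * lebesgue_rV (cone A))%E.

(* A great hypersphere H together with an ordering (H^+, H^-) of the two closed
   halfspheres it bounds amounts to a unit normal vector u, with
   H^+ = halfsphere u and H^- = halfsphere (- u). *)
Definition floating_body k (P : set 'rV[R]_k.+1) (delta : R) :
    set 'rV[R]_k.+1 :=
  \bigcap_(u in [set u | sphere u /\
                         (svol (halfsphere (- u) `&` P) <= delta%:E)%E])
    (halfsphere u `&` P).

Definition Gamma (x : R) : R :=
  (\int[lebesgue_measure]_(t in `]0%R, +oo[) (t `^ (x - 1) * expR (- t)))%R.

End spherical_geometry.

Arguments sphere R k : clear implicits.

(* Main.v *)
Require Import Defs.
From HB Require Import structures.
From mathcomp Require Import all_boot all_order all_algebra.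
From mathcomp Require Import all_classical all_reals all_analysis.
From mathcomp Require Import measurable_realfun ring lra.
Import Order.TTheory GRing.Theory Num.Theory.
Import numFieldNormedType.Exports.

Local Open Scope classical_set_scope.
Local Open Scope ring_scope.

Set Implicit Arguments.
Unset Strict Implicit.
Unset Printing Implicit Defensive.

(** A great hypersphere whose normal [u] makes the angle [t] with [e] cuts off from
    the halfsphere centered at [e] a lune of angle [t]. Lunes of equal angle are
    congruent, and adjacent lunes add up, so the volume of a lune is [t / (2 * pi)]
    times that of the sphere (vol_lune, svol_lune). The hyperspheres that cut off
    at most [delta] are therefore those whose normal is within the angle
    [a = 2 * pi * delta / vol (S^n)] of [e], and the floating body is the polar cap
    [sin a <= dotp v e] (floating_body_halfsphere). What has been removed is the
    zone of the points of latitude between [0] and [a]. Its volume is equivalent to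
    [a] times that of the equator [S^(n-1)] (vol_slab), and dividing by [delta]
    gives the first expression of the limit.

    All spherical volumes are those of cones in the unit ball (svol_cone), hence
    values of the Lebesgue measure of the vector space. The congruence of lunes
    only needs the invariance of this measure under reflections
    (lebesgue_rV_refl): a rotation of the plane of [e] and [u] is a product of two
    of them, and one reflection brings [e] to the first coordinate axis, along
    which the zone is sliced. This invariance is proved as in the uniqueness of
    translation invariant measures, from Tonelli's theorem and the invariance of
    the unit ball.

    The second expression of the limit comes from the volumes of the balls,
    obtained by computing the Gaussian integral once as a product of
    one-dimensional integrals and once by layers (sphere_vol_Gamma). *)

(** * Lebesgue measure on row vectors *)
Section sigma_finite_measure_of.
Context d (T : measurableType d) (R : realType).
Variables (m : {measure set T -> \bar R}) (sm : sigma_finite setT m).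

Let m' : set T -> \bar R := m.
HB.instance Definition _ := Measure.on m'.
HB.instance Definition _ := Measure_isSigmaFinite.Build _ _ _ m' sm.

Lemma sigma_finite_measureP :
  exists m' : {sigma_finite_measure set T -> \bar R}, m' = m :> (set T -> \bar R).
Proof. by exists m'. Qed.

End sigma_finite_measure_of.

Section sigma_finite_constructions.
Context d1 d2 (T1 : measurableType d1) (T2 : measurableType d2) (R : realType).

Lemma product_sigma_finite (m1 : {sigma_finite_measure set T1 -> \bar R})
    (m2 : {sigma_finite_measure set T2 -> \bar R}) :
  sigma_finite setT (m1 \x m2)%E.
Proof.
have /sigma_finiteP[F [TF ndF mF]] := sigma_finiteT m1.
have /sigma_finiteP[G [TG ndG mG]] := sigma_finiteT m2.
exists (fun i => F i `*` G i); last first.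
  move=> i; have [? ?] := mF i; have [? ?] := mG i; split.
    exact: measurableX.
  by rewrite product_measure1E// lte_mul_pinfty// ge0_fin_numE.
apply/esym; rewrite -subTset => -[x y] _.
have [i _ Fi] : (\bigcup_i F i) x by rewrite -TF.
have [j _ Gj] : (\bigcup_i G i) y by rewrite -TG.
exists (maxn i j) => //; split => /=.
  by have /subsetPset := ndF _ _ (leq_maxl i j); apply.
by have /subsetPset := ndG _ _ (leq_maxr i j); apply.
Qed.

(** The left inverse [g] carries an exhausting sequence of [T1] to one of [T2];
    this is how the measure of a product of lines reaches tuples, and then
    vectors. *)
Lemma pushforward_sigma_finite (m : {sigma_finite_measure set T1 -> \bar R})
    (f : T1 -> T2) (g : T2 -> T1) :
  cancel f g -> measurable_fun setT f -> measurable_fun setT g ->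
  exists m' : {sigma_finite_measure set T2 -> \bar R},
    m' = pushforward m f :> (set T2 -> \bar R).
Proof.
move=> fK mf mg; have [F TF mF] := sigma_finiteT m.
pose pm : {measure set T2 -> \bar R} := pushforward m f.
suff sp : sigma_finite setT (pm mf) by exact: sigma_finite_measureP sp.
exists (fun i => g @^-1` F i); first by rewrite -preimage_bigcup -TF.
move=> i; have [? ?] := mF i; split.
  by rewrite -[X in measurable X]setTI; exact: mg.
rewrite /= /pushforward (_ : _ @^-1` _ = F i)//.
by apply/seteqP; split=> x; rewrite /= fK.
Qed.

End sigma_finite_constructions.

(** [lebesgue_tuple] is a recursively defined set function. The product of two
    measures is a measure once the second factor is sigma-finite, so both
    properties have to go through the recursion together. *)
Lemma lebesgue_tuple_measure (R : realType) n :
  exists m : {sigma_finite_measure set (n.-tuple (measurableTypeR R)) -> \bar R},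
    m = @lebesgue_tuple R n :> (set _ -> \bar R).
Proof.
elim: n => [|n [m mE]]; first by exists \d_([tuple]).
rewrite /= -mE.
pose f (p : measurableTypeR R * n.-tuple (measurableTypeR R)) :=
  [the n.+1.-tuple (measurableTypeR R) of p.1 :: p.2].
have mf : measurable_fun setT f by exact: measurable_cons.
have mg : measurable_fun setT (fun t : n.+1.-tuple (measurableTypeR R) =>
    (thead t, [tuple of behead t])).
  apply/measurable_fun_pair => /=; first exact: measurable_tnth.
  exact: measurable_behead.
have sp := product_sigma_finite lebesgue_measure m.
have [m2 m2E] := sigma_finite_measureP sp.
have fK : cancel f (fun t => (thead t, [tuple of behead t])).
  by move=> [x t]; congr pair; apply/val_inj.
have [m3 m3E] := pushforward_sigma_finite m2 fK mf mg.
by exists m3; rewrite m3E m2E.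
Qed.

Section rV_measurable.
Variable R : realType.

Definition row_of_tuple n (t : n.-tuple (measurableTypeR R)) : 'rV[R]_n :=
  \row_i tnth t i.

Definition tuple_of_row n (v : 'rV[R]_n) : n.-tuple (measurableTypeR R) :=
  [tuple v 0 i | i < n].

Lemma row_of_tupleK n : cancel (@row_of_tuple n) (@tuple_of_row n).
Proof. by move=> t; apply/eq_from_tnth => i; rewrite tnth_mktuple mxE. Qed.

Lemma tuple_of_rowK n : cancel (@tuple_of_row n) (@row_of_tuple n).
Proof. by move=> v; apply/rowP => i; rewrite mxE tnth_mktuple. Qed.

(** Vectors carry the sigma-algebra transported from tuples, so that the
    coordinates generate it and products of vector spaces have Tonelli's
    theorem. *)
Definition measurable_rV n : set (set 'rV[R]_n) :=
  [set A | measurable (@row_of_tuple n @^-1` A)].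

Let measurable_rV0 n : @measurable_rV n set0.
Proof. by rewrite /measurable_rV /= preimage_set0. Qed.

Let measurable_rVC n (A : set 'rV[R]_n) :
  measurable_rV A -> measurable_rV (~` A).
Proof. by move=> mA; rewrite /measurable_rV /= preimage_setC; exact: measurableC. Qed.

Let measurable_rV_bigcup n (F : (set 'rV[R]_n)^nat) :
  (forall i, measurable_rV (F i)) -> measurable_rV (\bigcup_i F i).
Proof.
by move=> mF; rewrite /measurable_rV /= preimage_bigcup; exact: bigcupT_measurable.
Qed.

HB.instance Definition _ n := @isMeasurable.Build default_measure_display
  'rV[R]_n (@measurable_rV n) (@measurable_rV0 n) (@measurable_rVC n)
  (@measurable_rV_bigcup n).

Lemma measurable_row_of_tuple n : measurable_fun setT (@row_of_tuple n).
Proof. by move=> _ A mA; rewrite setTI. Qed.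

Lemma measurable_coord n (i : 'I_n) :
  measurable_fun setT (fun v : 'rV[R]_n => v 0 i).
Proof.
move=> _ A mA; rewrite setTI /measurable /= /measurable_rV /=.
have := @measurable_tnth _ (measurableTypeR R) n i measurableT A mA.
rewrite setTI; congr measurable.
by apply/seteqP; split=> t /=; rewrite mxE.
Qed.

Lemma measurable_fun_rV d (T : measurableType d) n (f : T -> 'rV[R]_n) :
  (forall i, measurable_fun setT (fun x => f x 0 i)) -> measurable_fun setT f.
Proof.
move=> mf; have mg : measurable_fun setT (@tuple_of_row n \o f).
  apply/measurable_fun_tnthP => i.
  by apply: eq_measurable_fun (mf i) => x _ /=; rewrite tnth_mktuple.
move=> _ A mA; rewrite setTI.
have := mg measurableT _ mA; rewrite setTI; congr measurable.
by apply/seteqP; split=> x /=; rewrite tuple_of_rowK.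
Qed.

Lemma measurable_tuple_of_row n : measurable_fun setT (@tuple_of_row n).
Proof.
apply/measurable_fun_tnthP => i.
by apply: eq_measurable_fun (measurable_coord i) => v _ /=; rewrite tnth_mktuple.
Qed.

Lemma lebesgue_rV_measure n :
  exists m : {sigma_finite_measure set 'rV[R]_n -> \bar R},
    m = @lebesgue_rV R n :> (set _ -> \bar R).
Proof.
have [m mE] := lebesgue_tuple_measure R n.
have [m' m'E] := pushforward_sigma_finite m (@row_of_tupleK n)
  (@measurable_row_of_tuple n) (@measurable_tuple_of_row n).
by exists m'; rewrite m'E /pushforward mE.
Qed.

Let leb n := projT1 (cid (lebesgue_rV_measure n)).
Let lebE n : leb n = @lebesgue_rV R n :> (set _ -> \bar R).
Proof. exact: projT2 (cid (lebesgue_rV_measure n)). Qed.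

Let lebesgue_rV0 n : @lebesgue_rV R n set0 = 0%E.
Proof. by rewrite -lebE measure0. Qed.

Let lebesgue_rV_ge0 n (A : set 'rV[R]_n) : (0 <= lebesgue_rV A)%E.
Proof. by rewrite -lebE measure_ge0. Qed.

Let lebesgue_rV_sigma_additive n : semi_sigma_additive (@lebesgue_rV R n).
Proof. by rewrite -lebE; exact: measure_semi_sigma_additive. Qed.

Let lebesgue_rV_sigma_finite n : sigma_finite setT (@lebesgue_rV R n).
Proof. by rewrite -lebE; exact: sigma_finiteT. Qed.

HB.instance Definition _ n := isMeasure.Build _ _ _ (@lebesgue_rV R n)
  (@lebesgue_rV0 n) (@lebesgue_rV_ge0 n) (@lebesgue_rV_sigma_additive n).

HB.instance Definition _ n :=
  Measure_isSigmaFinite.Build _ _ _ (@lebesgue_rV R n) (@lebesgue_rV_sigma_finite n).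

Definition vcons n (x : R) (y : 'rV[R]_n) : 'rV[R]_n.+1 :=
  \row_i oapp (y 0) x (unlift ord0 i).

Lemma vcons0 n x (y : 'rV[R]_n) : vcons x y 0 0 = x.
Proof. by rewrite mxE unlift_none. Qed.

Lemma vconsS n x (y : 'rV[R]_n) i : vcons x y 0 (lift 0 i) = y 0 i.
Proof. by rewrite mxE liftK. Qed.

Lemma measurable_vcons n :
  measurable_fun setT (fun p : measurableTypeR R * 'rV[R]_n => vcons p.1 p.2).
Proof.
apply: measurable_fun_rV => i; case: (unliftP 0 i) => [j|] ->.
  apply: (eq_measurable_fun ((fun v : 'rV_n => v 0 j) \o snd)) => [p _ /=|].
    by rewrite vconsS.
  by apply: measurableT_comp => //; exact: measurable_coord.
by apply: (eq_measurable_fun fst) => // p _ /=; rewrite vcons0.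
Qed.

Lemma row_of_tuple_cons n x (t : n.-tuple (measurableTypeR R)) :
  row_of_tuple [tuple of x :: t] = vcons x (row_of_tuple t).
Proof.
apply/rowP => i; case: (unliftP 0 i) => [j|] ->.
  by rewrite vconsS !mxE tnthS.
by rewrite vcons0 mxE.
Qed.

Lemma lebesgue_rVS n (A : set 'rV[R]_n.+1) :
  (lebesgue_rV A =
   \int[@lebesgue_measure R]_x lebesgue_rV [set y | A (vcons x y)])%E.
Proof.
rewrite /lebesgue_rV /= /pushforward /product_measure1.
apply: eq_integral => x _ /=; congr lebesgue_tuple.
by apply/seteqP; split => t; rewrite /xsection /= ?inE /= -row_of_tuple_cons.
Qed.

(** Tonelli's theorem along the first coordinate: all computations in dimension
    [n.+1] below are reduced to dimension [n] in this way. *)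
Lemma integral_rVS n (f : 'rV[R]_n.+1 -> \bar R) :
  measurable_fun setT f -> (forall v, 0 <= f v)%E ->
  (\int[@lebesgue_rV R n.+1]_v f v =
   \int[@lebesgue_measure R]_x \int[@lebesgue_rV R n]_y f (vcons x y))%E.
Proof.
move=> mf f0.
pose m : {measure set 'rV[R]_n.+1 -> \bar R} :=
   pushforward (@lebesgue_measure R \x @lebesgue_rV R n)%E (fun p => vcons p.1 p.2).
transitivity (\int[m (@measurable_vcons n)]_v f v)%E.
  apply: eq_measure_integral => /= A mA _; rewrite lebesgue_rVS /pushforward /product_measure1.
  apply: eq_integral => x _ /=; congr lebesgue_rV.
  by apply/seteqP; split => t; rewrite /xsection /= ?inE.
rewrite ge0_integral_pushforward//; last exact: measurable_vcons.
rewrite fubini_tonelli1//=.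
  exact: sigma_finiteT.
exact: measurableT_comp mf (@measurable_vcons n).
Qed.

End rV_measurable.

(** * Homotheties and translations *)
Section lebesgue_affine.
Variable R : realType.
Local Notation mu := (@lebesgue_measure R).

Lemma lebesgue_measure_affine (a b : R) (A : set (measurableTypeR R)) :
  0 < a -> measurable A -> mu [set x | A (a * x + b)] = (a^-1%:E * mu A)%E.
Proof.
move=> a0 mA.
have mf : measurable_fun setT
    ((fun x => a * x + b) : measurableTypeR R -> measurableTypeR R).
  by apply: measurable_funD => //; exact: measurable_funM.
pose nu0 : {measure set (measurableTypeR R) -> \bar R} :=
  pushforward mu (fun x : measurableTypeR R => a * x + b : measurableTypeR R).
pose nu : {measure set (measurableTypeR R) -> \bar R} :=
  mscale (NngNum (ltW a0)) (nu0 mf).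
rewrite [mu A](@lebesgue_measure_unique R nu)//.
  rewrite /nu /= /mscale /= muleA -EFinM mulVf ?gt_eqF// mul1e.
  by rewrite /nu0 /pushforward.
move=> _ [[u v] _ <-]; rewrite /nu /= /mscale /= /nu0 /pushforward.
rewrite (_ : _ @^-1` _ = `](u - b) / a, (v - b) / a]%classic); last first.
  apply/seteqP; split => x; rewrite /= !in_itv/= ltr_pdivrMr// ler_pdivlMr//.
    by move=> /andP[? ?]; apply/andP; split; lra.
  by move=> /andP[? ?]; apply/andP; split; lra.
rewrite !lebesgue_measure_itv /= !lte_fin ltr_pM2r ?invr_gt0// ltrD2r.
case: ifPn => _; last by rewrite mule0.
by rewrite -!EFinB -EFinM; congr EFin; field; rewrite gt_eqF.
Qed.

Lemma integral_affine (a b : R) (f : measurableTypeR R -> \bar R) :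
  0 < a -> measurable_fun setT f -> (forall x, 0 <= f x)%E ->
  (\int[mu]_x f (a * x + b)%R = a^-1%:E * \int[mu]_x f x)%E.
Proof.
move=> a0 mf f0.
have mg : measurable_fun setT
    ((fun x => a * x + b) : measurableTypeR R -> measurableTypeR R).
  by apply: measurable_funD => //; exact: measurable_funM.
have ia0 : 0 <= a^-1 by rewrite invr_ge0 ltW.
have := ge0_integral_pushforward mg mu measurableT mf (fun y _ => f0 y).
rewrite preimage_setT /comp => <-.
rewrite -(@ge0_integral_mscale _ _ _ mu setT measurableT (NngNum ia0))//.
apply: eq_measure_integral => A mA _.
by rewrite /pushforward /= /mscale /= -(@lebesgue_measure_affine a b).
Qed.

End lebesgue_affine.

Section sections.
Variable R : realType.
Local Notation mu := (@lebesgue_measure R).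
Variable n : nat.

Lemma measurable_vcons_section (A : set 'rV[R]_n.+1) x :
  measurable A -> measurable [set y : 'rV[R]_n | A (vcons x y)].
Proof.
move=> mA; have := @measurable_vcons R n measurableT _ mA.
rewrite setTI => /(measurable_xsection x); congr measurable.
by apply/seteqP; split => y; rewrite /xsection /= ?inE.
Qed.

Lemma measurable_lebesgue_section (A : set 'rV[R]_n.+1) : measurable A ->
  measurable_fun setT
    (fun x : measurableTypeR R => lebesgue_rV [set y | A (vcons x y)]).
Proof.
move=> mA; have := @measurable_vcons R n measurableT _ mA.
rewrite setTI => /(measurable_fun_xsection (@lebesgue_rV R n)).
apply: eq_measurable_fun => x _ /=; congr lebesgue_rV.
by apply/seteqP; split => y; rewrite /xsection /= ?inE.
Qed.

End sections.

(** Slicing along the first coordinate: each slice scales by [a^-1 ^+ n] by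
    induction, and the remaining integral over the line scales by [a^-1]. *)
Lemma lebesgue_rV_affine (R : realType) n (a : R) (b : 'rV[R]_n) (A : set 'rV[R]_n) :
  0 < a -> measurable A ->
  lebesgue_rV [set v | A (a *: v + b)] = ((a^-1 ^+ n)%:E * lebesgue_rV A)%E.
Proof.
move=> a0; elim: n => [|n ih] in b A *; move=> mA.
  rewrite expr0 mul1e; congr lebesgue_rV; apply/seteqP.
  by split=> v; rewrite /= (_ : _ + _ = v)//; apply/rowP => -[].
pose b' : 'rV[R]_n := \row_i b 0 (lift 0 i).
pose h (x : measurableTypeR R) := lebesgue_rV [set y | A (vcons x y)].
have ia0 : 0 <= a^-1 by rewrite invr_ge0 ltW.
have mh : measurable_fun setT h by exact: measurable_lebesgue_section.
have h0 x : (0 <= h x)%E by exact: measure_ge0.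
rewrite !lebesgue_rVS -/h.
transitivity (\int[@lebesgue_measure R]_x ((a^-1 ^+ n)%:E * h (a * x + b 0 0)%R))%E.
  apply: eq_integral => x _.
  rewrite /h -(ih b') //; last exact: measurable_vcons_section.
  congr lebesgue_rV; apply/seteqP; split=> y /=; congr A; apply/rowP => i;
    by case: (unliftP 0 i) => [j|] ->; rewrite ?mxE ?unlift_none ?liftK /= ?mxE.
rewrite ge0_integralZl//; last first.
- by rewrite lee_fin exprn_ge0.
- apply: (measurableT_comp mh).
  by apply: measurable_funD => //; exact: measurable_funM.
by rewrite integral_affine// muleA -EFinM exprSr.
Qed.

(** * Gaussian integral and the volume of balls *)
Section dotp_theory.
Variable R : realType.

Lemma dotpC n (u v : 'rV[R]_n) : dotp u v = dotp v u.
Proof. by apply: eq_bigr => i _; rewrite mulrC. Qed.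

Lemma dotpDl n (u v w : 'rV[R]_n) : dotp (u + v) w = dotp u w + dotp v w.
Proof. by rewrite -big_split; apply: eq_bigr => i _; rewrite mxE mulrDl. Qed.

Lemma dotpZl n (a : R) (u w : 'rV[R]_n) : dotp (a *: u) w = a * dotp u w.
Proof. by rewrite [RHS]mulr_sumr; apply: eq_bigr => i _; rewrite mxE mulrA. Qed.

Lemma dotpNl n (u w : 'rV[R]_n) : dotp (- u) w = - dotp u w.
Proof. by rewrite -scaleN1r dotpZl mulN1r. Qed.

Lemma dotpDr n (u v w : 'rV[R]_n) : dotp w (u + v) = dotp w u + dotp w v.
Proof. by rewrite dotpC dotpDl !(dotpC w). Qed.

Lemma dotpZr n (a : R) (u w : 'rV[R]_n) : dotp w (a *: u) = a * dotp w u.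
Proof. by rewrite dotpC dotpZl dotpC. Qed.

Lemma dotpNr n (u w : 'rV[R]_n) : dotp w (- u) = - dotp w u.
Proof. by rewrite dotpC dotpNl dotpC. Qed.

Definition dotpE := (dotpDl, dotpDr, dotpNl, dotpNr, dotpZl, dotpZr).

Lemma dotp_ge0 n (v : 'rV[R]_n) : 0 <= dotp v v.
Proof. by apply: sumr_ge0 => i _; rewrite -expr2 sqr_ge0. Qed.

Lemma dotp_eq0 n (v : 'rV[R]_n) : (dotp v v == 0) = (v == 0).
Proof.
apply/eqP/eqP => [|->]; last by rewrite -(scale0r 0) dotpZl mul0r.
move/psumr_eq0P => v0; apply/rowP => i; rewrite mxE.
by apply/eqP; rewrite -sqrf_eq0 expr2 v0// => j _; rewrite -expr2 sqr_ge0.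
Qed.

Lemma dotp_vcons n x x' (y y' : 'rV[R]_n) :
  dotp (vcons x y) (vcons x' y') = x * x' + dotp y y'.
Proof.
rewrite /dotp big_ord_recl !vcons0; congr (_ + _).
by apply: eq_bigr => i _; rewrite !vconsS.
Qed.

Lemma measurable_dotp d (T : measurableType d) n (f g : T -> 'rV[R]_n) :
  measurable_fun setT f -> measurable_fun setT g ->
  measurable_fun setT (fun x => dotp (f x) (g x)).
Proof.
move=> mf mg; apply: measurable_sum => i; apply: measurable_funM.
  exact: measurableT_comp (measurable_coord i) mf.
exact: measurableT_comp (measurable_coord i) mg.
Qed.

Lemma measurable_le_set d (T : measurableType d) (f g : T -> R) :
  measurable_fun setT f -> measurable_fun setT g ->
  measurable [set x | f x <= g x].
Proof.
move=> mf mg.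
by have := measurable_fun_ler mf mg measurableT (I : measurable [set true]); rewrite setTI.
Qed.

Lemma measurable_lt_set d (T : measurableType d) (f g : T -> R) :
  measurable_fun setT f -> measurable_fun setT g ->
  measurable [set x | f x < g x].
Proof.
move=> mf mg.
by have := measurable_fun_ltr mf mg measurableT (I : measurable [set true]); rewrite setTI.
Qed.

End dotp_theory.

(** The parameter is the squared radius, which keeps square roots out of the
    measurability and layer-cake arguments. *)
Definition sqball (R : realType) n (t : R) : set 'rV[R]_n :=
  [set v | dotp v v <= t].
Arguments sqball {R} n t.

Section gauss.
Variable R : realType.
Local Notation mu := (@lebesgue_measure R).

Lemma measurable_sqball n (t : R) : measurable (sqball n t).
Proof. by apply: measurable_le_set => //; exact: measurable_dotp. Qed.

Lemma lebesgue_rV0T : lebesgue_rV [set: 'rV[R]_0] = 1%E.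
Proof. by rewrite /lebesgue_rV /= /dirac indicE mem_set. Qed.

(** The Gaussian density is a product over the coordinates. *)
Lemma integral_rV_gauss n :
  (\int[@lebesgue_rV R n]_v (expR (- dotp v v))%:E = (Num.sqrt pi ^+ n)%:E)%E.
Proof.
elim: n => [|n ih].
  rewrite (eq_integral (cst 1%E)); last first.
    by move=> v _; rewrite /dotp big_ord0 oppr0 expR0.
  by rewrite integral_cst// mul1e; exact: lebesgue_rV0T.
have mg m : measurable_fun setT (fun v : 'rV[R]_m => (expR (- dotp v v))%:E).
  apply/measurable_EFinP/measurableT_comp => //.
  by apply: measurableT_comp => //; exact: measurable_dotp.
rewrite integral_rVS//.
transitivity (\int[mu]_x ((gauss_fun x)%:E * (Num.sqrt pi ^+ n)%:E))%E.
  apply: eq_integral => x _; rewrite -ih -ge0_integralZl//; last 2 first.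
  - exact: mg.
  - by rewrite lee_fin expR_ge0.
  apply: eq_integral => v _.
  by rewrite dotp_vcons opprD expRD EFinM /gauss_fun expr2.
rewrite ge0_integralZr//; last 2 first.
- by apply/measurable_EFinP; exact: measurable_gauss_fun.
- by move=> x _; rewrite lee_fin gauss_fun_ge0.
by rewrite integralT_gauss -EFinM exprS.
Qed.

Lemma sqball_volume n (t : R) : 0 < t ->
  lebesgue_rV (sqball n t) = ((Num.sqrt t ^+ n)%:E * lebesgue_rV (sqball n (1:R)))%E.
Proof.
move=> t0; have st0 : 0 < Num.sqrt t by rewrite sqrtr_gt0.
have ist0 : 0 < (Num.sqrt t)^-1 by rewrite invr_gt0.
rewrite -[X in X ^+ n]invrK -(lebesgue_rV_affine 0)//; last exact: measurable_sqball.
congr lebesgue_rV; apply/seteqP; split => v; rewrite /sqball /= addr0 !dotpE;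
  by rewrite mulrA -expr2 exprVn sqr_sqrtr ?(ltW t0)// mulrC ler_pdivrMr// mul1r.
Qed.

Lemma integral_expRN (a : R) :
  (\int[mu]_(t in `[a, +oo[) (expR (- t))%:E = (expR (- a))%:E)%E.
Proof.
rewrite (@ge0_continuous_FTC2y _ _ (fun t => - expR (- t)) a 0).
- by rewrite sub0e -EFinN opprK.
- by move=> x _; rewrite expR_ge0.
- apply: continuous_subspaceT => x; apply: continuous_comp; first exact: opp_continuous.
  exact: continuous_expR.
- by rewrite -oppr0; apply: cvgN; exact: cvgr_expR.
- by move=> x _; exact: ex_derive.
- apply: cvg_at_right_filter; apply: cvgN; apply: continuous_comp; first exact: opp_continuous.
  exact: continuous_expR.
- move=> x _; rewrite derive1E derive_val; ring.
Qed.

End gauss.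

Lemma integralM_indic d (T : measurableType d) (R : realType)
    (m : {measure set T -> \bar R}) (D : set T) (g : T -> R) :
  (\int[m]_x (g x * \1_D x)%:E = \int[m]_(x in D) (g x)%:E)%E.
Proof.
rewrite [RHS]integral_mkcond; apply: eq_integral => x _.
by rewrite /patch indicE; case: (x \in D); rewrite ?mulr1 ?mulr0.
Qed.

Section ball_volume.
Variable R : realType.
Local Notation mu := (@lebesgue_measure R).

(** Euler's integral with values in the extended reals: its convergence is then
    a consequence of the identities below instead of a prerequisite. *)
Definition GammaE (a : R) : \bar R :=
  (\int[mu]_(t in `]0%R, +oo[) (t `^ (a - 1) * expR (- t))%:E)%E.

Lemma GammaE_ge0 a : (0 <= GammaE a)%E.
Proof.
by apply: integral_ge0 => t _; rewrite lee_fin mulr_ge0 ?powR_ge0 ?expR_ge0.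
Qed.

Lemma GammaEK a : Gamma a = fine (GammaE a). Proof. by []. Qed.

Lemma measurable_expRN (D : set (measurableTypeR R)) :
  measurable_fun D (fun t : measurableTypeR R => expR (- t)).
Proof. by apply: measurable_funTS; apply: measurableT_comp. Qed.

(** The constraint [0 < t] only matters when [a = 0], where it removes one
    point. *)
Lemma integral_expRN_pos (a : R) : 0 <= a ->
  (\int[mu]_(t in [set t | ((a <= t) && (0 < t))%R]) (expR (- t))%:E = (expR (- a))%:E)%E.
Proof.
rewrite le_eqVlt => /predU1P[<-|a0].
  rewrite -integral_expRN -integral_itv_obnd_cbnd; last first.
    by apply/measurable_EFinP; exact: measurable_expRN.
  rewrite (_ : [set t | _] = `]0, +oo[%classic)//; apply/seteqP.
  split => t; rewrite /= in_itv/= andbT; first by case/andP.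
  by move=> t0; rewrite t0 ltW.
rewrite -integral_expRN.
rewrite (_ : [set t | _] = `[a, +oo[%classic)//; apply/seteqP.
split => t; rewrite /= in_itv/= andbT; first by case/andP.
by move=> at0; rewrite at0 (lt_le_trans a0).
Qed.

(** Layer-cake form of the Gaussian integral: write [expR (- dotp v v)] as the
    integral of [expR (- t)] over [t >= dotp v v] and exchange the two
    integrals. *)
Lemma sqball_layer_cake n :
  (\int[mu]_(t in `]0%R, +oo[) ((expR (- t))%:E * lebesgue_rV (sqball n t)) =
   (Num.sqrt pi ^+ n)%:E)%E.
Proof.
pose E : set ('rV[R]_n * measurableTypeR R) :=
  [set p | (dotp p.1 p.1 <= p.2) && (0 < p.2)].
have mE : measurable E.
  rewrite (_ : E = [set p | dotp p.1 p.1 <= p.2] `&` [set p | 0 < p.2]).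
    apply: measurableI; last exact: measurable_lt_set.
    by apply: measurable_le_set => //; exact: measurable_dotp.
  by apply/seteqP; split => p /= /andP.
pose f (p : 'rV[R]_n * measurableTypeR R) : \bar R := (expR (- p.2) * \1_E p)%:E.
have mf : measurable_fun setT f.
  apply/measurable_EFinP/measurable_funM; last exact: measurable_indic.
  exact: (measurableT_comp (@measurable_expRN setT)).
have f0 p : (0 <= f p)%E by rewrite lee_fin mulr_ge0 ?expR_ge0.
have := @fubini_tonelli _ _ _ _ R (@lebesgue_rV R n) mu f mf f0.
rewrite (_ : (\int[_]_x _)%E = (Num.sqrt pi ^+ n)%:E); last first.
  rewrite -integral_rV_gauss; apply: eq_integral => v _.
  rewrite -integral_expRN_pos ?dotp_ge0// -[RHS]integralM_indic.
  by apply: eq_integral => t _; rewrite /f !indicE.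
move=> ->; rewrite [LHS]integral_mkcond; apply: eq_integral => t _.
rewrite /patch mem_setE in_itv /= andbT; case: ifPn => t0.
  rewrite -[in LHS](setIT (sqball n t)) -integral_indic//; last exact: measurable_sqball.
  rewrite -ge0_integralZl//; last first.
    by apply/measurable_EFinP; apply: measurable_indic; exact: measurable_sqball.
  apply: eq_integral => v _; rewrite /f -EFinM /= !indicE; congr (_ * (nat_of_bool _)%:R)%:E.
  by apply/idP/idP; rewrite !inE /sqball /E/= t0 andbT.
rewrite integral0_eq// => v _; rewrite /f indicE memNset ?mulr0//=.
by rewrite /E /= (negbTE t0) andbF.
Qed.

(** The ball of squared radius [t] has volume [t `^ (n / 2)] times that of the
    unit ball, so the layer-cake integral is an Euler integral. *)
Lemma GammaE_ball n :
  (lebesgue_rV (sqball n (1 : R)) * GammaE (n%:R / 2 + 1) = (Num.sqrt pi ^+ n)%:E)%E.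
Proof.
rewrite -sqball_layer_cake muleC -ge0_integralZr//; last 2 first.
- apply/measurable_EFinP; apply: measurable_funM; last exact: measurable_expRN.
  by apply: measurable_funTS; exact: measurable_powR.
- by move=> t _; rewrite lee_fin mulr_ge0 ?powR_ge0 ?expR_ge0.
apply: eq_integral => t; rewrite inE /= in_itv /= andbT => t0.
rewrite [in RHS](sqball_volume _ t0) muleA -EFinM addrK [in RHS]mulrC.
congr ((_ * _)%:E * _)%E.
by rewrite mulrC powRrM powR12_sqrt ?powR_mulrn ?sqrtr_ge0 ?ltW.
Qed.

(** A product of two nonnegative extended reals that is finite and positive has
    finite and positive factors. *)
Lemma sqball1_fin_pos n :
  0 < fine (lebesgue_rV (sqball n (1 : R))) /\
  lebesgue_rV (sqball n (1 : R)) \is a fin_num.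
Proof.
have := GammaE_ball n; have := GammaE_ge0 (n%:R / 2 + 1).
have : (0 <= lebesgue_rV (sqball n (1 : R)))%E by exact: measure_ge0.
have pos : 0 < Num.sqrt (pi : R) ^+ n by rewrite exprn_gt0// sqrtr_gt0 pi_gt0.
case: (lebesgue_rV _) => [r| |]//; case: GammaE => [g| |]//.
- rewrite !lee_fin => r0 g0 [rg]; split=> //=.
  by rewrite lt_neqAle r0 andbT; apply/eqP => r0'; rewrite -rg -r0' mul0r ltxx in pos.
- rewrite lee_fin le_eqVlt => /predU1P[<-|r0] _.
    by rewrite mul0e => -[p0]; rewrite -p0 ltxx in pos.
  by rewrite gt0_muley// lte_fin.
- rewrite lee_fin => _; rewrite le_eqVlt => /predU1P[<-|g0].
    by rewrite mule0 => -[p0]; rewrite -p0 ltxx in pos.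
  by rewrite gt0_mulye// lte_fin.
Qed.

End ball_volume.

(** * Functional equation of the Gamma function *)
Section Gamma_recursion.
Variable R : realType.
Local Notation mu := (@lebesgue_measure R).

Lemma derivable_powRr (a s : R) : 0 < s -> derivable (fun x => x `^ a) s 1.
Proof. by move=> s0; apply: derivable_powR; rewrite in_itv/= s0. Qed.

Lemma continuous_powRr (a s : R) : 0 < s -> {for s, continuous (fun x => x `^ a)}.
Proof.
by move=> s0; apply: differentiable_continuous; apply/derivable1_diffP/derivable_powRr.
Qed.

Lemma integral_powR_segment (a e t : R) : 0 < e < t ->
  (\int[mu]_(s in `[e, t]) (a * s `^ (a - 1))%:E = (t `^ a)%:E - (e `^ a)%:E)%E.
Proof.
move=> /andP[e0 et]; rewrite (@continuous_FTC2 _ _ (fun x => x `^ a))//.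
- apply/continuous_within_itvP => //; split.
  + move=> x; rewrite in_itv/= => /andP[ex _]; apply: cvgM; first exact: cvg_cst.
    by apply: continuous_powRr; exact: lt_trans ex.
  + apply: cvg_at_right_filter; apply: cvgM; first exact: cvg_cst.
    exact: continuous_powRr.
  + apply: cvg_at_left_filter; apply: cvgM; first exact: cvg_cst.
    by apply: continuous_powRr; exact: lt_trans et.
- split.
  + move=> x; rewrite in_itv/= => /andP[ex _]; apply: derivable_powRr; exact: lt_trans ex.
  + by apply: cvg_at_right_filter; exact: continuous_powRr.
  + by apply: cvg_at_left_filter; apply: continuous_powRr; exact: lt_trans et.
- move=> x; rewrite in_itv/= => /andP[ex _].
  by rewrite powR_derive1// in_itv/= andbT; exact: lt_trans ex.
Qed.

(** For [a < 1] the integrand blows up at [0], so the fundamental theorem of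
    calculus is applied on the segments [[t / k.+2, t]], which exhaust the
    interval. *)
Lemma integral_powR (a t : R) : 0 < a -> 0 < t ->
  (\int[mu]_(s in `]0%R, t]) (a * s `^ (a - 1))%:E = (t `^ a)%:E)%E.
Proof.
move=> a0 t0.
pose F k : set (measurableTypeR R) := `[t / k.+2%:R, t]%classic.
have dk k : 0 < t / k.+2%:R < t.
  by rewrite divr_gt0// ltr_pdivrMr// ltr_pMr// ltr1n.
have UF : \bigcup_k F k = `]0, t]%classic.
  apply/seteqP; split => [s [k _]|s]; rewrite /F /= !in_itv/= => /andP[s1 s2].
    by rewrite s2 (lt_le_trans _ s1)//; case/andP: (dk k).
  have [k kt] : exists k, t / s < k%:R.
    by exists (Num.bound (t / s)); apply: archi_boundP; rewrite divr_ge0// ltW.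
  exists k => //=; rewrite in_itv/= s2 andbT ler_pdivrMr//.
  rewrite mulrC -ler_pdivrMr//; apply: (le_trans (ltW kt)).
  by rewrite ler_nat -addn2 leq_addr.
have cv : (\int[mu]_(s in F k) (a * s `^ (a - 1))%:E)%E @[k --> \oo] --> (t `^ a)%:E.
  rewrite [X in X @ _ --> _](_ : _ = fun k => (t `^ a - (t / k.+2%:R) `^ a)%:E); last first.
    by apply/funext => k; rewrite integral_powR_segment.
  apply: cvg_EFin; first exact: nearW.
  rewrite -[X in _ --> X]subr0; apply: cvgB; first exact: cvg_cst.
  have /cvg_at_rightP := powR_cvg0 a0; apply; split.
    by move=> k; case/andP: (dk k).
  rewrite -(mulr0 t); apply: cvgM; first exact: cvg_cst.
  by have := @cvg_harmonic R; rewrite -cvg_shiftS; apply.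
have := @ge0_nondecreasing_set_cvg_integral _ _ R F
  (fun s => (a * s `^ (a - 1))%:E) mu.
rewrite UF => cv'; apply: (cvg_unique _ _ cv) => //; apply: cv'.
- apply/nondecreasing_seqP => k; apply/subsetPset => s; rewrite /F /= !in_itv/=.
  move=> /andP[s1 ->]; rewrite andbT; apply: le_trans s1.
  by rewrite ler_pM2l// lef_pV2 ?posrE// ler_nat.
- by move=> k; exact: measurable_itv.
- move=> k; apply/measurable_EFinP; apply: measurable_funM => //.
  by apply: measurable_funTS; exact: measurable_powR.
- by move=> k x _; rewrite lee_fin mulr_ge0 ?powR_ge0 ?ltW.
Qed.

(** Integration by parts in the form of an exchange of integrals, over the region
    [0 < s <= t] and with the density [a * s `^ (a - 1) * expR (- t)]: integrating
    [t] first gives the right-hand side, integrating [s] first the left-hand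
    one. *)
Lemma GammaES (a : R) : 0 < a -> GammaE (a + 1) = (a%:E * GammaE a)%E.
Proof.
move=> a0.
pose E : set (measurableTypeR R * measurableTypeR R) :=
  [set p | (0 < p.1) && (p.1 <= p.2)].
have mE : measurable E.
  rewrite (_ : E = [set p | p.1 <= p.2] `&` [set p | 0 < p.1]).
    apply: measurableI; last exact: measurable_lt_set.
    exact: measurable_le_set.
  by apply/seteqP; split => p /=; [case/andP|case=> ? ?; apply/andP].
pose g (p : measurableTypeR R * measurableTypeR R) : R :=
  a * p.1 `^ (a - 1) * expR (- p.2).
pose f p : \bar R := (g p * \1_E p)%:E.
have mg : measurable_fun setT g.
  apply: measurable_funM.
    by apply: measurable_funM => //;
      exact: (measurableT_comp (measurable_powR (a - 1)) measurable_fst).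
  exact: (measurableT_comp (@measurable_expRN R setT)).
have mf : measurable_fun setT f.
  by apply/measurable_EFinP/measurable_funM => //; exact: measurable_indic.
have f0 p : (0 <= f p)%E.
  by rewrite lee_fin mulr_ge0// mulr_ge0 ?expR_ge0// mulr_ge0 ?powR_ge0// ltW.
have := @fubini_tonelli _ _ _ _ R mu mu f mf f0.
have mpe (b : R) : measurable_fun (`]0%R, +oo[ : set (measurableTypeR R))
    (fun t : measurableTypeR R => (t `^ b * expR (- t))%:E).
  apply/measurable_EFinP; apply: measurable_funM; last exact: measurable_expRN.
  by apply: measurable_funTS; exact: measurable_powR.
have -> : (\int[mu]_x \int[mu]_y f (x, y) = a%:E * GammaE a)%E.
  rewrite /GammaE -ge0_integralZl//; last 2 first.
  - by move=> t _; rewrite lee_fin mulr_ge0 ?powR_ge0 ?expR_ge0.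
  - by rewrite lee_fin ltW.
  rewrite [RHS]integral_mkcond; apply: eq_integral => s _.
  rewrite /patch mem_setE in_itv /= andbT; case: ifPn => s0.
    transitivity (\int[mu]_(t in `[s, +oo[) ((a * s `^ (a - 1))%:E * (expR (- t))%:E))%E.
      rewrite [RHS]integral_mkcond; apply: eq_integral => t _.
      rewrite /f /g /patch mem_setE in_itv /= andbT indicE.
      rewrite (_ : (_ \in E) = (s <= t)); last first.
        by apply/idP/idP; rewrite inE /E /= s0.
      by case: ifPn => st; rewrite ?mulr1 ?mulr0.
    rewrite ge0_integralZl//; last 2 first.
    - by apply/measurable_EFinP; exact: measurable_expRN.
    - by rewrite lee_fin mulr_ge0 ?powR_ge0// ltW.
    by rewrite integral_expRN -!EFinM mulrA.
  rewrite integral0_eq// => t _; rewrite /f indicE memNset ?mulr0//=.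
  by rewrite /E /= (negbTE s0).
have -> : (\int[mu]_y \int[mu]_x f (x, y) = GammaE (a + 1))%E.
  rewrite /GammaE addrK [RHS]integral_mkcond; apply: eq_integral => t _.
  rewrite /patch mem_setE in_itv /= andbT; case: ifPn => t0.
    rewrite EFinM -integral_powR// muleC -ge0_integralZl//; last 2 first.
    - apply/measurable_EFinP; apply: measurable_funM => //.
      by apply: measurable_funTS; exact: measurable_powR.
    - by move=> s _; rewrite lee_fin mulr_ge0 ?powR_ge0 ?ltW.
    rewrite [RHS]integral_mkcond; apply: eq_integral => s _.
    rewrite /f /g /patch mem_setE in_itv /= indicE.
    rewrite (_ : (_ \in E) = (0 < s <= t)); last first.
      by apply/idP/idP; rewrite inE.
    by case: ifPn => st; rewrite ?mulr1 ?mulr0// -EFinM mulrC.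
  rewrite integral0_eq// => s _; rewrite /f indicE memNset ?mulr0//=.
  rewrite /E /= => /andP[s0 st]; move: t0; rewrite (lt_le_trans s0 st)//.
by [].
Qed.

End Gamma_recursion.

(** * Invariance under reflections *)
Section reflections.
Variable R : realType.

(** Orthogonal reflection in the hyperplane normal to [d]. Since [0^-1 = 0], the
    reflection along [0] is the identity, which spares case distinctions. *)
Definition refl n (d x : 'rV[R]_n) : 'rV[R]_n :=
  x - (2 * dotp x d / dotp d d) *: d.

Lemma refl0 n (x : 'rV[R]_n) : refl 0 x = x.
Proof. by rewrite /refl scaler0 subr0. Qed.

Lemma reflD n (d x y : 'rV[R]_n) : refl d (x + y) = refl d x + refl d y.
Proof. by rewrite /refl dotpDl mulrDr mulrDl scalerDl opprD addrACA. Qed.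

Lemma dotp_refl n (d x y : 'rV[R]_n) : dotp (refl d x) (refl d y) = dotp x y.
Proof.
have [->|d0] := eqVneq d 0; first by rewrite !refl0.
rewrite /refl !dotpE (dotpC d y); field.
by rewrite dotp_eq0.
Qed.

Lemma reflK n (d : 'rV[R]_n) : involutive (refl d).
Proof.
move=> x; have [->|d0] := eqVneq d 0; first by rewrite !refl0.
rewrite {1}/refl {2}/refl !dotpE {1}/refl -addrA -opprD -scalerDl.
rewrite [X in X *: d](_ : _ = 0) ?scale0r ?subr0//; field.
by rewrite dotp_eq0.
Qed.

(** Any two vectors of the same length are exchanged by a reflection. *)
Lemma refl_sub n (a b : 'rV[R]_n) : dotp a a = dotp b b -> refl (a - b) a = b.
Proof.
move=> ab; have [/eqP|d0] := eqVneq (a - b) 0.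
  by rewrite subr_eq0 => /eqP ->; rewrite subrr refl0.
rewrite /refl [X in X *: _](_ : _ = 1) ?scale1r ?opprB 1?addrC ?subrK//.
have := d0; rewrite -dotp_eq0 !dotpE -ab (dotpC b a) => d0'.
by field; apply: contra_neq d0' => ?; lra.
Qed.

Lemma measurable_refl n (d : 'rV[R]_n) : measurable_fun setT (refl d).
Proof.
apply: measurable_fun_rV => i; rewrite /refl.
apply: (eq_measurable_fun (fun x : 'rV[R]_n =>
  x 0 i - (2 * dotp x d / dotp d d) * d 0 i)) => [x _|]; first by rewrite !mxE.
apply: measurable_funB; first exact: measurable_coord.
apply: measurable_funM => //; apply: measurable_funM => //; apply: measurable_funM => //.
exact: measurable_dotp.
Qed.

Lemma lebesgue_rV_translate n (b : 'rV[R]_n) (A : set 'rV[R]_n) : measurable A ->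
  lebesgue_rV [set v | A (v + b)] = lebesgue_rV A.
Proof.
move=> mA; have := lebesgue_rV_affine b ltr01 mA.
rewrite invr1 expr1n mul1e => <-; congr lebesgue_rV.
by apply/seteqP; split => v; rewrite /= scale1r.
Qed.

Section additive_involution.
Variables (n : nat) (T : 'rV[R]_n -> 'rV[R]_n).
Hypotheses (TD : {morph T : x y / x + y}) (TK : involutive T).
Hypothesis mT : measurable_fun setT T.
Local Notation L := (@lebesgue_rV R n).

(** The usual proof that a translation invariant measure is unique up to a
    factor. Exchange the integrals over [x] and [y] of the indicator function of
    [A (T x) /\ B (T x + y)]: the slices at fixed [x] are translates of [B], and
    the slices at fixed [y] are, up to the translation of [x] by [T y], those of
    [B (T x) /\ A (T x - y)], whose slices at fixed [x] are translates of
    the set of all [- v] with [A v]. *)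
Lemma lebesgue_rV_involution_mul (A B : set 'rV[R]_n) :
  measurable A -> measurable B ->
  (lebesgue_rV (T @^-1` A) * lebesgue_rV B =
   lebesgue_rV (T @^-1` B) * lebesgue_rV [set v | A (- v)%R])%E.
Proof.
move=> mA mB.
have mpre (C : set 'rV[R]_n) : measurable C -> measurable (T @^-1` C).
  by move=> mC; rewrite -[X in measurable X]setTI; exact: mT.
have mrV (f : 'rV[R]_n * 'rV[R]_n -> 'rV[R]_n) (C : set 'rV[R]_n) :
    (forall i, measurable_fun setT (fun p => f p 0 i)) -> measurable C ->
    measurable (f @^-1` C).
  move=> mf mC; rewrite -[X in measurable X]setTI.
  by apply: (measurable_fun_rV mf) => //.
have mTx i : measurable_fun setT (fun p : 'rV[R]_n * 'rV[R]_n => T p.1 0 i).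
  have := measurableT_comp (measurable_coord i) (measurableT_comp mT measurable_fst).
  exact.
have my i : measurable_fun setT (fun p : 'rV[R]_n * 'rV[R]_n => p.2 0 i).
  exact: (measurableT_comp (measurable_coord i) measurable_snd).
pose E : set ('rV[R]_n * 'rV[R]_n) := [set p | A (T p.1) /\ B (T p.1 + p.2)].
pose F : set ('rV[R]_n * 'rV[R]_n) := [set p | B (T p.1) /\ A (T p.1 - p.2)].
have mE : measurable E.
  apply: (@measurableI _ _ ((fun p => T p.1) @^-1` A) ((fun p => T p.1 + p.2) @^-1` B)).
    exact: mrV.
  apply: mrV => // i; under eq_fun do rewrite mxE.
  exact: measurable_funD.
have mF : measurable F.
  apply: (@measurableI _ _ ((fun p => T p.1) @^-1` B) ((fun p => T p.1 - p.2) @^-1` A)).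
    exact: mrV.
  apply: mrV => // i; under eq_fun do rewrite !mxE.
  exact: measurable_funB.
have mN : measurable [set v : 'rV[R]_n | A (- v)%R].
  rewrite -[X in measurable X]setTI.
  apply: (@measurable_fun_rV _ _ _ _ (fun v : 'rV[R]_n => - v)) => // i.
  under eq_fun do rewrite mxE.
  by apply: measurableT_comp => //; exact: measurable_coord.
have indicL G : measurable G -> (L G = \int[L]_x (\1_G x)%:E)%E.
  by move=> mG; rewrite integral_indic// setIT.
have fub G : measurable G ->
    (\int[L]_x L (xsection G x) = \int[L]_y L (ysection G y))%E.
  move=> mG; have := @indic_fubini_tonelli _ _ _ _ R L L G mG.
  by rewrite indic_fubini_tonelli_FE// indic_fubini_tonelli_GE.
have -> : (L (T @^-1` A) * L B = \int[L]_x L (xsection E x))%E.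
  rewrite muleC (indicL (T @^-1` _)); last exact: mpre.
  rewrite -ge0_integralZl//; last first.
    by apply/measurable_EFinP; apply: measurable_indic; exact: mpre.
  apply: eq_integral => x _; rewrite indicE; case: (boolP (x \in _)) => [|/negP].
    rewrite inE /= => ATx; rewrite mule1 -(lebesgue_rV_translate (T x) mB).
    congr (L _); apply/seteqP; split => y; rewrite /xsection /= inE addrC; first by split.
    by case.
  rewrite inE /= => ATx; rewrite mule0 (_ : xsection _ _ = set0) ?measure0//.
  by apply/seteqP; split => // y; rewrite /xsection /= inE => -[].
have -> : (L (T @^-1` B) * L [set v | A (- v)%R] = \int[L]_x L (xsection F x))%E.
  rewrite muleC (indicL (T @^-1` _)); last exact: mpre.
  rewrite -ge0_integralZl//; last first.
    by apply/measurable_EFinP; apply: measurable_indic; exact: mpre.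
  apply: eq_integral => x _; rewrite indicE; case: (boolP (x \in _)) => [|/negP].
    rewrite inE /= => BTx; rewrite mule1 -(lebesgue_rV_translate (- T x) mN).
    congr (L _); apply/seteqP; split => y; rewrite /xsection /= inE opprD opprK addrC; first by split.
    by case.
  rewrite inE /= => ATx; rewrite mule0 (_ : xsection _ _ = set0) ?measure0//.
  by apply/seteqP; split => // y; rewrite /xsection /= inE => -[].
rewrite !fub//; apply: eq_integral => y _.
rewrite -[RHS](lebesgue_rV_translate (T y)); last exact: measurable_ysection.
congr (L _); apply/seteqP; split => x; rewrite /ysection /= !inE /E /F /= TD TK addrK;
  by case.
Qed.

End additive_involution.

(** The previous lemma is used twice with [B] the unit ball, for the reflection
    and for the identity. The ball is its own preimage under both, and the same
    right-hand side appears, so that the volume of the ball cancels. *)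
Lemma lebesgue_rV_refl n (d : 'rV[R]_n) (A : set 'rV[R]_n) : measurable A ->
  lebesgue_rV [set v | A (refl d v)] = lebesgue_rV A.
Proof.
move=> mA; have mB := @measurable_sqball R n 1.
have [B0 Bf] := sqball1_fin_pos R n.
have /= := lebesgue_rV_involution_mul (@reflD n d) (@reflK n d) (@measurable_refl n d) mA mB.
rewrite (_ : refl d @^-1` sqball n 1 = sqball n 1); last first.
  by apply/seteqP; split => x; rewrite /sqball /preimage /= dotp_refl.
have /= := @lebesgue_rV_involution_mul n id _ _ _ A (sqball n 1) mA mB.
rewrite preimage_id => <- //.
move: B0 Bf; case: (lebesgue_rV (sqball n 1)) => // r /= r0 _.
by move=> /(congr1 (fun x => x * (r^-1)%:E)%E); rewrite -!muleA -EFinM divff ?gt_eqF// !mule1.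
Qed.

End reflections.

(** * The volume of a lune *)

(** Cauchy's functional equation on an interval. Cut [y] in [n] steps
    [h = y / n] and let [k] be the number of steps that fit in [x]: additivity
    gives [L y = n * L h], and [L x] differs from [x / h * L h] by at most
    [L h = L y / n], which is arbitrarily small. *)
Lemma additive_linear (R : realType) (M : R) (L : R -> R) :
  (forall x, 0 <= x < M -> 0 <= L x) ->
  (forall x y, 0 <= x -> 0 <= y -> x + y < M -> L (x + y) = L x + L y) ->
  forall x y, 0 < x < M -> 0 < y < M -> L x = x / y * L y.
Proof.
move=> L0 LD x y /andP[x0 xM] /andP[y0 yM].
have LN m h : 0 <= h -> m%:R * h < M -> L (m%:R * h) = m%:R * L h.
  move=> h0; elim: m => [|m ih] mM.
    have : L (0 + 0) = L 0 + L 0 by rewrite LD// addr0 -(mul0r h).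
    by rewrite addr0 !mul0r; lra.
  rewrite -natr1 mulrDl mul1r in mM *.
  rewrite LD//; last by rewrite mulr_ge0.
  by rewrite ih ?mulrDl ?mul1r//; apply: le_lt_trans mM; rewrite lerDl.
apply/eqP; rewrite -subr_eq0 -normr_eq0 -[_ == 0]negbK; apply/negP => D0.
set D := `|_| in D0; have {D0}D0 : 0 < D by rewrite lt_neqAle eq_sym D0 normr_ge0.
have Ly0 : 0 <= L y by rewrite L0// (ltW y0).
pose n := (Num.bound (L y / D)).+1.
have nD : L y / D < n%:R.
  by apply: (lt_trans (archi_boundP _)); rewrite ?divr_ge0 ?(ltW D0)// ltr_nat.
have n0 : 0 < n%:R :> R by rewrite ltr0n.
pose h := y / n%:R.
have h0 : 0 < h by rewrite divr_gt0.
have nh : n%:R * h = y by rewrite /h mulrC divfK// gt_eqF.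
have LyE : L y = n%:R * L h by rewrite -nh LN ?nh// ltW.
have hy : h <= y by rewrite /h ler_pdivrMr// ler_pMr// ler1n.
have Lh0 : 0 <= L h by rewrite L0// ltW//= (le_lt_trans hy).
pose k := Num.trunc (x / h).
have /andP[kx xk] : k%:R <= x / h < k.+1%:R.
  by apply: Num.Theory.truncn_itv; rewrite divr_ge0// ltW.
have khx : k%:R * h <= x by rewrite -ler_pdivlMr.
have xkh : x - k%:R * h < h.
  by move: xk; rewrite ltr_pdivrMr// -natr1 mulrDl mul1r; lra.
pose r := x - k%:R * h.
have r0 : 0 <= r by rewrite subr_ge0.
have LxE : L x = k%:R * L h + L r.
  rewrite -(LN k h (ltW h0) (le_lt_trans khx xM)) -LD//.
  - by rewrite /r addrC subrK.
  - by rewrite mulr_ge0// ltW.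
  - by rewrite /r addrC subrK.
have Lr0 : 0 <= L r.
  by rewrite L0// r0/=; apply: le_lt_trans xM; rewrite /r lerBlDr lerDl mulr_ge0// ltW.
have Lrh : L r <= L h.
  have -> : L h = L r + L (h - r).
    rewrite -LD//; first by rewrite addrC subrK.
    - by rewrite subr_ge0 ltW.
    - by rewrite addrC subrK (le_lt_trans hy).
  rewrite lerDl L0// subr_ge0 ltW//=.
  by apply: le_lt_trans yM; apply: le_trans hy; rewrite lerBlDr lerDl.
have DE : D = `|(k%:R - x / h) * L h + L r|.
  congr `|_|; rewrite LxE LyE -nh; field.
  by rewrite !gt_eqF.
have : D <= L h.
  rewrite DE ler_norml; apply/andP; split.
    have : (x / h - k%:R) * L h <= 1 * L h.
      by rewrite ler_wpM2r//; rewrite -natr1 in xk; lra.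
    lra.
  have : 0 <= (x / h - k%:R) * L h by rewrite mulr_ge0// subr_ge0.
  lra.
rewrite leNgt => /negP; apply.
rewrite -(ltr_pM2l n0) -LyE.
by move: nD; rewrite ltr_pdivrMr.
Qed.

Section ball_parts.
Variables (R : realType) (n : nat).
Local Notation L := (@lebesgue_rV R n.+1).
Local Notation B := (sqball n.+1 (1 : R)).
Local Notation vec := 'rV[R]_n.+1.

Definition vol (A : set vec) : R := fine (L A).

Lemma ball_part_fin (A : set vec) : measurable A -> A `<=` B -> L A \is a fin_num.
Proof.
move=> mA AB; have [_ Bf] := sqball1_fin_pos R n.+1.
rewrite ge0_fin_numE ?measure_ge0//.
apply: (@le_lt_trans _ _ (L B)); last by rewrite -ge0_fin_numE ?measure_ge0.
by rewrite le_measure ?inE//; exact: measurable_sqball.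
Qed.

Lemma vol_ge0 (A : set vec) : 0 <= vol A.
Proof. by rewrite fine_ge0// measure_ge0. Qed.

Lemma volU (A A' : set vec) : measurable A -> measurable A' ->
  A `<=` B -> A' `<=` B -> [disjoint A & A'] -> vol (A `|` A') = vol A + vol A'.
Proof.
move=> mA mA' AB A'B dA; rewrite /vol measureU//; last exact/disj_set2P.
by rewrite fineD// ball_part_fin.
Qed.

Lemma measurable_dotp_ge0 (u : vec) : measurable [set w : vec | 0 <= dotp w u].
Proof. by apply: measurable_le_set => //; exact: measurable_dotp. Qed.

Lemma measurable_dotp_gt0 (u : vec) : measurable [set w : vec | 0 < dotp w u].
Proof. by apply: measurable_lt_set => //; exact: measurable_dotp. Qed.

Lemma measurable_dotp_lt0 (u : vec) : measurable [set w : vec | dotp w u < 0].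
Proof. by apply: measurable_lt_set => //; exact: measurable_dotp. Qed.

Lemma measurable_hyperplane (u : vec) : measurable [set w : vec | dotp w u = 0].
Proof.
rewrite (_ : [set _ | _] = [set w : vec | 0 <= dotp w u] `\` [set w : vec | 0 < dotp w u]).
  by apply: measurableD; [exact: measurable_dotp_ge0|exact: measurable_dotp_gt0].
apply/seteqP; split => w /=; first by move=> ->; rewrite lexx ltxx.
by move=> [w0 /negP]; rewrite -leNgt => w1; apply/eqP; rewrite eq_le w0 w1.
Qed.

Definition axis0 : vec := delta_mx 0 0.

Lemma dotp_axis0 (w : vec) : dotp w axis0 = w 0 0.
Proof.
rewrite /dotp (bigD1 0)//= big1 ?addr0 ?mxE ?eqxx ?mulr1// => i i0.
by rewrite mxE (negbTE i0) andbF mulr0.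
Qed.

Lemma dotp_axis0_self : dotp axis0 axis0 = 1.
Proof. by rewrite dotp_axis0 mxE !eqxx. Qed.

Lemma dotp_refl_swap (u u' v : vec) : dotp u u = dotp u' u' ->
  dotp (refl (u - u') v) u' = dotp v u.
Proof. by move=> uu'; rewrite -{2}(refl_sub uu') dotp_refl. Qed.

(** By a reflection the normal becomes the first basis vector, and then all the
    slices but one are empty. *)
Lemma lebesgue_rV_hyperplane (u : vec) : dotp u u = 1 -> L [set w | dotp w u = 0] = 0%E.
Proof.
move=> u1; have uu0 : dotp u u = dotp axis0 axis0 by rewrite dotp_axis0_self.
transitivity (L [set w | dotp w axis0 = 0]).
  rewrite -(lebesgue_rV_refl (u - axis0) (measurable_hyperplane axis0)).
  by congr (L _); apply/seteqP; split => w /=; rewrite dotp_refl_swap.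
rewrite lebesgue_rVS.
transitivity (\int[@lebesgue_measure R]_(x in [set 0%R])
    lebesgue_rV [set y : 'rV[R]_n | dotp (vcons x y) axis0 = 0%R])%E.
  rewrite [RHS]integral_mkcond; apply: eq_integral => x _; rewrite /patch.
  case: ifPn => //; rewrite notin_setE /= => /eqP x0.
  rewrite (_ : [set y | _] = set0) ?measure0//.
  apply/seteqP; split => // y /=; rewrite dotp_axis0 vcons0 => /eqP.
  by rewrite (negbTE x0).
by rewrite integral_set1.
Qed.

Lemma lebesgue_rV_eq_mod_hyperplane (u : vec) (A A' : set vec) : dotp u u = 1 ->
  measurable A -> measurable A' -> A `<=` A' ->
  A' `<=` A `|` [set w | dotp w u = 0] -> L A' = L A.
Proof.
move=> u1 mA mA' AA' A'A; apply/eqP; rewrite eq_le; apply/andP; split; last first.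
  by rewrite le_measure ?inE.
have mH := measurable_hyperplane u.
apply: (@le_trans _ _ (L (A `|` [set w | dotp w u = 0]))).
  by rewrite le_measure ?inE//; exact: measurableU.
apply: (le_trans (measureU2 _ mA mH)).
by rewrite [X in (_ + X)%E]lebesgue_rV_hyperplane// adde0.
Qed.

(** The reflection along [u] exchanges the two open halves of [A], and the
    boundary between them is a null set. *)
Lemma vol_half (u : vec) (A : set vec) : dotp u u = 1 ->
  measurable A -> A `<=` B -> (forall w, A (refl u w) <-> A w) ->
  vol (A `&` [set w | 0 <= dotp w u]) = vol A / 2 /\
  vol (A `&` [set w | dotp w u < 0]) = vol A / 2.
Proof.
move=> u1 mA AB Au.
set P := A `&` _; set N := A `&` _.
have mP : measurable P by apply: measurableI => //; exact: measurable_dotp_ge0.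
have mN : measurable N by apply: measurableI => //; exact: measurable_dotp_lt0.
have -> : vol A = vol P + vol N.
  rewrite -volU//.
  - congr vol; apply/seteqP; split => w; last by case=> -[].
    by move=> Aw; case: (leP 0 (dotp w u)); [left|right].
  - by move=> w [/AB].
  - by move=> w [/AB].
  - by apply/disj_setPS => w [[_ /=] w0 [_ /=]]; rewrite ltNge w0.
have -> : vol P = vol N.
  pose P' := A `&` [set w | 0 < dotp w u].
  have mP' : measurable P' by apply: measurableI => //; exact: measurable_dotp_gt0.
  rewrite /vol (@lebesgue_rV_eq_mod_hyperplane u P' P)//; last 2 first.
  - by move=> w [Aw /ltW].
  - move=> w [Aw /=]; rewrite le_eqVlt => /predU1P[<-|w0]; first by right.
    by left.
  rewrite -(lebesgue_rV_refl u mP'); congr (fine (L _)); apply/seteqP.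
  have ref w : dotp (refl u w) u = - dotp w u.
    by rewrite /refl !dotpE u1; lra.
  by split => w [/= /Au Aw]; rewrite ?ref ?oppr_gt0 => w0; split; rewrite //= ref oppr_gt0.
by split; lra.
Qed.

End ball_parts.

Section lunes.
Variables (R : realType) (n : nat).
Local Notation L := (@lebesgue_rV R n.+1).
Local Notation B := (sqball n.+1 (1 : R)).
Local Notation vec := 'rV[R]_n.+1.

(** The solid lune cut out of the unit ball. One of its two faces is left out, so
    that adjacent lunes are disjoint. *)
Definition lune (a b : vec) : set vec :=
  B `&` [set w | 0 <= dotp w a] `&` [set w | dotp w b < 0].

Lemma measurable_lune a b : measurable (lune a b).
Proof.
apply: measurableI; last exact: measurable_dotp_lt0.
by apply: measurableI; [exact: measurable_sqball|exact: measurable_dotp_ge0].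
Qed.

Lemma lune_sub a b : lune a b `<=` B. Proof. by move=> w [[]]. Qed.

Lemma vol_lune_refl d a b : vol (lune (refl d a) (refl d b)) = vol (lune a b).
Proof.
rewrite /vol -(lebesgue_rV_refl d (measurable_lune _ _)); congr (fine (L _)).
by apply/seteqP; split => w; rewrite /lune /sqball /= !dotp_refl.
Qed.

Section orthonormal_pair.
Variables e f : vec.
Hypotheses (ee : dotp e e = 1) (ff : dotp f f = 1) (ef : dotp e f = 0).

Definition circ (t : R) : vec := cos t *: e + sin t *: f.

(** On the circle the reflection along the direction of angle [s + pi / 2] is
    [t] |-> [2 s - t], so two of them compose to a rotation. *)
Lemma refl_circ (s t : R) :
  refl (- sin s *: e + cos s *: f) (circ t) = circ (s + s - t).
Proof.
have fe : dotp f e = 0 by rewrite dotpC.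
have cs1 := cos2Dsin2 s; set h := _ + cos s *: f.
have hh : dotp h h = 1.
  by rewrite /h !dotpE ee ff ef fe -[RHS]cs1; ring.
have th : dotp (circ t) h = sin t * cos s - cos t * sin s.
  by rewrite /h /circ !dotpE ee ff ef fe; ring.
rewrite /refl hh th divr1 /h /circ cosB sinB cosD sinD.
have oppE a b : - (a *: e + b *: f) = (- a) *: e + (- b) *: f.
  by rewrite !scaleNr opprD.
rewrite scalerDr !scalerA oppE addrACA -!scalerDl.
set cs := cos s in cs1 *; set ss := sin s in cs1 *.
have ct : cos t = cos t * (cs ^+ 2 + ss ^+ 2) by rewrite cs1 mulr1.
have st : sin t = sin t * (cs ^+ 2 + ss ^+ 2) by rewrite cs1 mulr1.
congr (_ *: _ + _ *: _); first by rewrite [X in X - _]ct; ring.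
by rewrite [X in X - _]st; ring.
Qed.

Lemma vol_lune_circ (s t p : R) :
  vol (lune (circ (s + p)) (circ (t + p))) = vol (lune (circ s) (circ t)).
Proof.
have flip r a b : vol (lune (circ (r + r - a)) (circ (r + r - b))) =
    vol (lune (circ a) (circ b)).
  by rewrite -!refl_circ vol_lune_refl.
rewrite -(flip 0 s t) -(flip (p / 2) (0 + 0 - s)).
have shift r : p / 2 + p / 2 - (0 + 0 - r) = r + p by field.
by rewrite !shift.
Qed.

Lemma circ0 : circ 0 = e.
Proof. by rewrite /circ cos0 sin0 scale1r scale0r addr0. Qed.

Lemma circ_pihalf : circ (pi / 2) = f.
Proof. by rewrite /circ cos_pihalf sin_pihalf scale1r scale0r add0r. Qed.

Lemma dotp_circ (w : vec) (t : R) : dotp w (circ t) = cos t * dotp w e + sin t * dotp w f.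
Proof. by rewrite /circ !dotpE. Qed.

(** Two orthogonal hyperplanes cut the ball into four parts of equal volume. *)
Lemma vol_lune_quarter : vol (lune e f) = vol B / 4.
Proof.
have mB : measurable B by exact: measurable_sqball.
have mBe : measurable (B `&` [set w : vec | 0 <= dotp w e]).
  by apply: measurableI; [exact: measurable_sqball|exact: measurable_dotp_ge0].
have [|Be _] := vol_half ee mB (fun=> id).
  by move=> w; rewrite /sqball /= dotp_refl.
have [|_ Bf] := vol_half ff mBe (@subIsetl _ B _).
  move=> w; rewrite /sqball /= dotp_refl.
  by rewrite (_ : dotp (refl f w) e = dotp w e)// /refl !dotpE (dotpC f) ef mulr0 subr0.
by rewrite /lune Bf Be; lra.
Qed.

(** The lune of angle [s + t] is the union of the lune of angle [s] and of a
    rotated copy of the lune of angle [t]. *)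
Lemma vol_lune_add (s t : R) : 0 <= s -> 0 <= t -> s + t < pi ->
  vol (lune e (circ (s + t))) = vol (lune e (circ s)) + vol (lune e (circ t)).
Proof.
have lee : vol (lune e e) = 0.
  rewrite /vol (_ : lune e e = set0) ?measure0//; apply/seteqP; split => // w.
  by move=> [[_ /=]]; rewrite leNgt => /negP.
rewrite le_eqVlt => /predU1P[<- _ _|s0]; first by rewrite add0r circ0 lee add0r.
rewrite le_eqVlt => /predU1P[<- _|t0 stpi]; first by rewrite addr0 circ0 lee addr0.
have := vol_lune_circ 0 t s; rewrite add0r circ0 (addrC t) => <-.
have ss : 0 < sin s by apply: sin_gt0_pi; rewrite s0 /=; lra.
have st : 0 < sin t by apply: sin_gt0_pi; rewrite t0 /=; lra.
have sst : 0 < sin (s + t) by apply: sin_gt0_pi; rewrite stpi andbT; lra.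
have rel w : sin s * dotp w (circ (s + t)) =
    sin (s + t) * dotp w (circ s) - sin t * dotp w e.
  rewrite !dotp_circ cosD sinD.
  have -> : sin t * dotp w e = sin t * dotp w e * (cos s ^+ 2 + sin s ^+ 2).
    by rewrite cos2Dsin2 mulr1.
  by ring.
rewrite -volU; try exact: measurable_lune; try exact: lune_sub; last first.
  apply/disj_setPS => w [[_ /=] w1 [[_ /=] w2 _]].
  by move: w1; rewrite ltNge w2.
congr vol; apply/seteqP; split => w.
  move=> [[/= Bw we] wst]; have [ws|ws] := leP 0 (dotp w (circ s)).
    by right.
  by left.
case=> [[[/= Bw we] ws]|[[/= Bw ws] wst]].
  split; first by split.
  have := rel w; have := mulr_ge0 (ltW st) we.
  have : sin (s + t) * dotp w (circ s) < 0 by rewrite pmulr_rlt0.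
  move=> h1 h2 h3; rewrite /= -(pmulr_rlt0 _ ss); lra.
split => //; split => //=.
have := rel w; have := mulr_ge0 (ltW sst) ws.
have : sin s * dotp w (circ (s + t)) < 0 by rewrite pmulr_rlt0.
move=> h1 h2 h3; rewrite -(pmulr_rge0 _ st); lra.
Qed.

(** The volume is additive in the angle, hence linear; the quarter ball fixes the
    factor. *)
Lemma vol_lune_angle (t : R) : 0 < t < pi ->
  vol (lune e (circ t)) = t / (2 * pi) * vol B.
Proof.
move=> tpi; have pi0 := pi_gt0 R.
rewrite (@additive_linear R pi (fun t => vol (lune e (circ t))) _ _ t (pi / 2))//.
- rewrite circ_pihalf vol_lune_quarter.
  have aux (p v : R) : 0 < p -> t / (p / 2) * (v / 4) = t / (2 * p) * v.
    by move=> p0; field; rewrite gt_eqF.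
  exact: aux.
- by move=> s _; exact: vol_ge0.
- exact: vol_lune_add.
- by apply/andP; split; lra.
Qed.

End orthonormal_pair.

Lemma orthonormal_decomposition (e u : vec) : dotp e e = 1 -> dotp u u = 1 ->
  dotp u e ^+ 2 < 1 ->
  exists f, [/\ dotp f f = 1, dotp e f = 0 &
    u = dotp u e *: e + Num.sqrt (1 - dotp u e ^+ 2) *: f].
Proof.
move=> ee uu t1; set t := dotp u e in t1 *; set s := Num.sqrt _.
have s0 : 0 < s by rewrite sqrtr_gt0 subr_gt0.
have s2 : s ^+ 2 = 1 - t ^+ 2 by rewrite sqr_sqrtr// subr_ge0 ltW.
exists (s^-1 *: (u - t *: e)); split.
- rewrite !dotpE ee uu (dotpC e) -/t.
  transitivity (s^-1 ^+ 2 * (1 - t ^+ 2)); first by ring.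
  by rewrite -s2 -exprMn mulVf ?expr1n// gt_eqF.
- by rewrite !dotpE (dotpC e u) -/t ee mulr1 subrr mulr0.
- by rewrite scalerA divff ?gt_eqF// scale1r addrC subrK.
Qed.

Lemma dotp_sqr_le1 (e u : vec) : dotp e e = 1 -> dotp u u = 1 -> dotp u e ^+ 2 <= 1.
Proof.
move=> ee uu; have := dotp_ge0 (u - dotp u e *: e).
rewrite !dotpE ee uu (dotpC e) => h; rewrite -subr_ge0; apply: (le_trans h).
by rewrite le_eqVlt; apply/orP; left; apply/eqP; ring.
Qed.

Lemma dotp_sqr_eq1 (e u : vec) : dotp e e = 1 -> dotp u u = 1 ->
  dotp u e ^+ 2 = 1 -> u = dotp u e *: e.
Proof.
move=> ee uu t1; apply/eqP; rewrite -subr_eq0 -dotp_eq0 !dotpE ee uu (dotpC e).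
by apply/eqP; move: t1; set t := dotp u e => t1; transitivity (1 - t ^+ 2); [ring|lra].
Qed.

Lemma vol_lune (e u : vec) : dotp e e = 1 -> dotp u u = 1 -> dotp u e ^+ 2 < 1 ->
  vol (lune e u) = acos (dotp u e) / (2 * pi) * vol B.
Proof.
move=> ee uu t1; have [f [ff ef ue]] := orthonormal_decomposition ee uu t1.
have tI : -1 < dotp u e < 1 by rewrite -ltr_norml -(expr_lt1 (n := 2))// ?real_normK ?num_real.
have tI' : -1 <= dotp u e <= 1 by case/andP: tI => /ltW -> /ltW ->.
rewrite -(vol_lune_angle ee ff ef).
  by rewrite /circ acosK ?sin_acos// -ue.
case/andP: tI => tl tr.
by apply/andP; split; [apply: acos_gt0|apply: acos_ltpi]; rewrite ?(ltW tl) ?(ltW tr) ?tl ?tr.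
Qed.

End lunes.

(** * Spherical volumes and the floating body *)
Section spherical_volume.
Variables (R : realType) (n : nat).
Local Notation L := (@lebesgue_rV R n.+1).
Local Notation B := (sqball n.+1 (1 : R)).
Local Notation vec := 'rV[R]_n.+1.

Lemma sphereE (v : vec) : sphere R n v = (dotp v v = 1).
Proof. by []. Qed.

(** The cone spanned by the unit vectors of [C] is the part of [C] in the unit
    ball, up to the origin: the origin belongs to the spanned cone exactly when
    that cone is not empty, whether or not it satisfies [C]. *)
Lemma svol_cone (C : set vec) : measurable C ->
  (forall t v, 0 < t -> C (t *: v) <-> C v) ->
  svol (sphere R n `&` C) = (n.+1%:R%:E * L (B `&` C))%E.
Proof.
move=> mC CZ; rewrite /svol; congr (_ * _)%E.
set K := cone _.
have m0 : measurable [set 0 : vec].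
  rewrite (_ : [set 0] = sqball n.+1 0); first exact: measurable_sqball.
  apply/seteqP; split => w; rewrite /sqball /=.
    by move=> ->; rewrite (eqP (_ : dotp 0 0 == 0)) ?dotp_eq0.
  by move=> w0; apply/eqP; rewrite -dotp_eq0 eq_le w0 dotp_ge0.
have mBC : measurable (B `&` C) by apply: measurableI => //; exact: measurable_sqball.
pose D := (B `&` C) `\` [set 0].
have mD : measurable D by exact: measurableD.
have DK : D `<=` K.
  move=> w [[Bw Cw] /eqP w0]; have ww0 : 0 < dotp w w.
    by rewrite lt_neqAle eq_sym dotp_eq0 w0 dotp_ge0.
  have s0 : 0 < Num.sqrt (dotp w w) by rewrite sqrtr_gt0.
  exists (Num.sqrt (dotp w w)), ((Num.sqrt (dotp w w))^-1 *: w); split.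
  - by rewrite ltW//= -sqrtr1 ler_wsqrtr.
  - split; last by apply/CZ; rewrite ?invr_gt0.
    rewrite sphereE !dotpE mulrA -expr2 exprVn sqr_sqrtr ?dotp_ge0//.
    by rewrite mulVf ?gt_eqF.
  - by rewrite scalerA divff ?scale1r ?gt_eqF.
have KD : K `<=` D `|` [set 0].
  move=> w [t [v [/andP[t0 t1] [v1 Cv] ->]]].
  have [->|tn0] := eqVneq t 0; first by right; rewrite /= scale0r.
  have {}t0 : 0 < t by rewrite lt_neqAle eq_sym tn0.
  left; split; last first.
    move=> /= /eqP; rewrite scaler_eq0 (negbTE tn0) /= => /eqP v0.
    move: v1; rewrite sphereE v0 => /eqP; rewrite (eqP (_ : dotp 0 0 == 0)) ?dotp_eq0//.
    by rewrite eq_sym oner_eq0.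
  split; last exact/CZ.
  by rewrite /sqball /= !dotpE (v1 : dotp v v = 1) mulr1 -expr2 expr_le1// ltW.
have mK : measurable K.
  have [K0|K0] := pselect (K 0).
    rewrite (_ : K = D `|` [set 0]); first exact: measurableU.
    by apply/seteqP; split => // w [/DK|->].
  rewrite (_ : K = D)//; apply/seteqP; split => // w Kw.
  by have [//|w0] := KD _ Kw; rewrite w0 in Kw.
have z0 : [set 0 : vec] `<=` [set w : vec | dotp w (axis0 R n) = 0].
  by move=> w ->; rewrite /= -(scale0r (0 : vec)) dotpZl mul0r.
rewrite (lebesgue_rV_eq_mod_hyperplane (dotp_axis0_self R n) mD mK DK); last first.
  by move=> w /KD[]; [left|right; exact: z0].
rewrite -(lebesgue_rV_eq_mod_hyperplane (dotp_axis0_self R n) mD mBC)//; first by move=> w [].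
move=> w BCw; have [->|/eqP w0] := eqVneq w 0; first by right; exact: z0.
by left.
Qed.

Definition sphere_vol : R := n.+1%:R * vol B.

Lemma sphere_vol_gt0 : 0 < sphere_vol.
Proof. by rewrite mulr_gt0//; have [] := sqball1_fin_pos R n.+1. Qed.

Lemma svol_cone_fin (C : set vec) : measurable C ->
  (forall t v, 0 < t -> C (t *: v) <-> C v) ->
  svol (sphere R n `&` C) = (n.+1%:R * vol (B `&` C))%:E.
Proof.
move=> mC CZ; rewrite svol_cone// EFinM /vol fineK//.
apply: ball_part_fin; last exact: subIsetl.
by apply: measurableI => //; exact: measurable_sqball.
Qed.

Lemma svol_sphere : svol (sphere R n) = sphere_vol%:E.
Proof. by rewrite -{1}(setIT (sphere R n)) svol_cone_fin ?setIT. Qed.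

Lemma svol_halfsphere (e : vec) : dotp e e = 1 ->
  svol (halfsphere e) = (sphere_vol / 2)%:E.
Proof.
move=> ee; rewrite (_ : halfsphere e = sphere R n `&` [set v | 0 <= dotp v e]); last first.
  by apply/seteqP; split => v /= [].
rewrite svol_cone_fin; last 2 first.
- exact: measurable_dotp_ge0.
- by move=> t v t0 /=; rewrite dotpZl pmulr_rge0.
have [] := vol_half ee (measurable_sqball (1 : R)) (fun=> id).
  by move=> w; rewrite /sqball /= dotp_refl.
by move=> -> _; rewrite mulrA.
Qed.

(** The part of the halfsphere centered at [e] that is cut off by the hypersphere
    normal to [u] is a lune whose angle is the angle between [u] and [e]. *)
Lemma svol_lune (e u : vec) : dotp e e = 1 -> dotp u u = 1 -> dotp u e ^+ 2 < 1 ->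
  svol (halfsphere (- u) `&` halfsphere e) =
  (acos (dotp u e) / (2 * pi) * sphere_vol)%:E.
Proof.
move=> ee uu ue.
pose C := [set v : vec | 0 <= dotp v e] `&` [set v | 0 <= dotp v (- u)].
have mC : measurable C by apply: measurableI; exact: measurable_dotp_ge0.
rewrite (_ : _ `&` _ = sphere R n `&` C); last first.
  apply/seteqP; split => v; first by move=> [[? ?] [? ?]].
  by move=> [? [? ?]].
rewrite svol_cone_fin//; last first.
  by move=> t v t0; rewrite /C /= !dotpZl !pmulr_rge0.
rewrite /sphere_vol mulrCA -vol_lune//; congr ((_ * fine _)%:E).
apply: (lebesgue_rV_eq_mod_hyperplane uu); first exact: measurable_lune.
- by apply: measurableI => //; exact: measurable_sqball.
- move=> w [[Bw we] /= wu]; split => //; split => //=.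
  by rewrite dotpNr oppr_ge0 ltW.
- move=> w [Bw [/= we]]; rewrite dotpNr oppr_ge0 le_eqVlt => /predU1P[wu|wu].
    by right.
  by left; split.
Qed.

(** Of two orthogonal unit vectors at least one is not a multiple of [e]. *)
Lemma exists_orthonormal (e : vec) : (1 <= n)%N -> dotp e e = 1 ->
  exists f, dotp f f = 1 /\ dotp e f = 0.
Proof.
move=> n1 ee; pose e1 : vec := delta_mx 0 ord_max.
have e11 : dotp e1 e1 = 1.
  rewrite /dotp (bigD1 ord_max)//= big1 ?addr0 ?mxE ?eqxx ?mulr1// => i i0.
  by rewrite !mxE (negbTE i0) andbF mulr0.
have e10 : dotp e1 (axis0 R n) = 0.
  rewrite dotp_axis0 mxE eqxx /= (_ : (0 == ord_max) = false)//.
  by rewrite -val_eqE /= eq_sym -leqn0 leqNgt n1.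
have [h|h] := ltP (dotp e1 e ^+ 2) 1.
  by have [f []] := orthonormal_decomposition ee e11 h; exists f.
have [h'|h'] := ltP (dotp (axis0 R n) e ^+ 2) 1.
  by have [f []] := orthonormal_decomposition ee (dotp_axis0_self R n) h'; exists f.
exfalso.
have E1 : dotp e1 e ^+ 2 = 1 by apply/eqP; rewrite eq_le h dotp_sqr_le1.
have E0 : dotp (axis0 R n) e ^+ 2 = 1.
  by apply/eqP; rewrite eq_le h' dotp_sqr_le1// dotp_axis0_self.
move: e10; rewrite (dotp_sqr_eq1 ee e11 E1) (dotp_sqr_eq1 ee (dotp_axis0_self R n) E0).
rewrite !dotpE ee mulr1 => /eqP; rewrite mulf_eq0 => /orP[]/eqP h0.
  by move: E1; rewrite h0 expr0n => /eqP; rewrite eq_sym oner_eq0.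
by move: E0; rewrite h0 expr0n => /eqP; rewrite eq_sym oner_eq0.
Qed.

(** By [svol_lune], the hyperspheres that cut off at most the given volume are
    those whose normal makes an angle at most [a] with [e]. A point of the floating
    body is tested against the normal at angle exactly [a] that leans away from it,
    which gives [sin a <= dotp v e]; conversely that inequality implies all the
    others by the Cauchy-Schwarz inequality. *)
Lemma floating_body_halfsphere (e : vec) (a : R) : (1 <= n)%N -> dotp e e = 1 ->
  0 < a < pi / 2 ->
  floating_body (halfsphere e) (a / (2 * pi) * sphere_vol) =
  sphere R n `&` [set v | sin a * Num.sqrt (dotp v v) <= dotp v e].
Proof.
move=> n1 ee /andP[a0 a2]; have pi0 := pi_gt0 R; have V0 := sphere_vol_gt0.
have sa : 0 < sin a by apply: sin_gt0_pi; rewrite a0 /=; lra.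
have ca : 0 < cos a by apply: cos_gt0_pihalf; rewrite a2 andbT; lra.
have cs := cos2Dsin2 a.
have k0 : 0 < sphere_vol / (2 * pi) by rewrite divr_gt0// mulr_gt0.
have cut (u : vec) : dotp u u = 1 -> dotp u e ^+ 2 < 1 ->
    ((svol (halfsphere (- u) `&` halfsphere e) <= (a / (2 * pi) * sphere_vol)%:E)%E
     = (cos a <= dotp u e)).
  move=> uu ue; rewrite svol_lune// lee_fin.
  rewrite -!mulrA ![(2 * pi)^-1 * _]mulrC ler_pM2r//.
  have tI : -1 < dotp u e < 1 by rewrite -ltr_norml -(expr_lt1 (n := 2))// ?real_normK ?num_real.
  have tI' : -1 <= dotp u e <= 1 by case/andP: tI => /ltW -> /ltW ->.
  have aI : a \in `[0, pi] by rewrite in_itv /=; apply/andP; split; lra.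
  have acI : acos (dotp u e) \in `[0, pi] by rewrite in_itv/= acos_ge0// acos_lepi.
  by rewrite -[in RHS](acosK tI') [RHS]leNgt ltr_cos// -leNgt.
have cut_circ f : dotp f f = 1 -> dotp e f = 0 -> let u := cos a *: e + sin a *: f in
    dotp u u = 1 /\
    (svol (halfsphere (- u) `&` halfsphere e) <= (a / (2 * pi) * sphere_vol)%:E)%E.
  move=> ff ef u; have fe : dotp f e = 0 by rewrite dotpC.
  have uu : dotp u u = 1 by rewrite /u !dotpE ee ff ef fe -[RHS]cs; ring.
  have ue : dotp u e = cos a by rewrite /u !dotpE ee fe mulr1 mulr0 addr0.
  split => //; rewrite cut// ue// -cs ltrDl exprn_gt0//.
apply/seteqP; split => v.
- move=> FBv.
  have [v1 ve] : halfsphere e v.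
    have [f [ff ef]] := exists_orthonormal n1 ee.
    by have [uu /(conj uu) ucut] := cut_circ f ff ef; have [] := FBv _ ucut.
  split => //=; rewrite (v1 : dotp v v = 1) sqrtr1 mulr1.
  have sa1 : sin a <= 1 by exact: sin_le1.
  have := dotp_sqr_le1 ee v1; rewrite le_eqVlt => /predU1P[ve1|ve1].
    have : (dotp v e - 1) * (dotp v e + 1) = 0 by move: ve1; lra.
    move/eqP; rewrite mulf_eq0 => /orP[|]/eqP; lra.
  have [g [gg eg vE]] := orthonormal_decomposition ee v1 ve1.
  set t := dotp v e in ve ve1 vE *; set s := Num.sqrt _ in vE.
  have s0 : 0 <= s by exact: sqrtr_ge0.
  have s2 : s ^+ 2 = 1 - t ^+ 2 by rewrite sqr_sqrtr// subr_ge0 ltW.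
  have Ng : dotp (- g) (- g) = 1 by rewrite !dotpE opprK.
  have Neg : dotp e (- g) = 0 by rewrite dotpNr eg oppr0.
  have [uu /(conj uu) ucut] := cut_circ _ Ng Neg.
  have [[_ +] _] := FBv _ ucut.
  have ge : dotp g e = 0 by rewrite dotpC.
  rewrite {1}vE !dotpE ee gg eg ge => h.
  have {}h : 0 <= t * cos a - s * sin a by move: h; lra.
  rewrite leNgt; apply/negP => ta.
  have : t ^+ 2 < sin a ^+ 2 by rewrite ltr_pXn2r// nnegrE ltW.
  move=> t2; have : cos a ^+ 2 < s ^+ 2 by lra.
  rewrite ltr_pXn2r ?nnegrE ?(ltW ca)// => cas.
  have : t * cos a < sin a * cos a by rewrite ltr_pM2r.
  have : cos a * sin a < s * sin a by rewrite ltr_pM2r.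
  lra.
- move=> [v1 /=]; rewrite (v1 : dotp v v = 1) sqrtr1 mulr1 => av.
  have ve : 0 <= dotp v e by apply: le_trans av; exact: ltW.
  have Pv : halfsphere e v by [].
  move=> u [uu ucut]; split => //; split => //.
  have := dotp_sqr_le1 ee uu; rewrite le_eqVlt => /predU1P[ue1|ue1].
    have uE := dotp_sqr_eq1 ee uu ue1.
    have : (dotp u e - 1) * (dotp u e + 1) = 0 by move: ue1; lra.
    move/eqP; rewrite mulf_eq0 subr_eq0 addr_eq0 => /orP[|]/eqP ue.
      by rewrite uE ue scale1r.
    move: ucut; rewrite uE ue scaleN1r opprK setIid svol_halfsphere// lee_fin => h.
    have : a / (2 * pi) < 1 / 2 by rewrite ltr_pdivrMr ?mulr_gt0//; lra.
    by rewrite -(ltr_pM2r V0) => h'; lra.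
  move: ucut; rewrite cut// => au.
  have [g [gg eg uE]] := orthonormal_decomposition ee uu ue1.
  set t := dotp u e in au ue1 uE *; set s := Num.sqrt _ in uE.
  have s0 : 0 <= s by exact: sqrtr_ge0.
  have s2 : s ^+ 2 = 1 - t ^+ 2 by rewrite sqr_sqrtr// subr_ge0 ltW.
  have ge : dotp g e = 0 by rewrite dotpC.
  have bessel : dotp v g ^+ 2 <= 1 - dotp v e ^+ 2.
    have := dotp_ge0 (v - dotp v e *: e - dotp v g *: g).
    rewrite !dotpE ee gg eg ge (v1 : dotp v v = 1) (dotpC e v) (dotpC g v); lra.
  rewrite uE !dotpE.
  have sas : s <= sin a.
    rewrite -(@ler_pXn2r _ 2)// ?nnegrE ?(ltW sa)// s2.
    have : cos a ^+ 2 <= t ^+ 2 by rewrite ler_pXn2r// nnegrE ltW// (lt_le_trans ca).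
    lra.
  have vg : `|dotp v g| <= cos a.
    rewrite -(@ler_pXn2r _ 2)// ?nnegrE ?(ltW ca)// real_normK ?num_real//.
    have : sin a ^+ 2 <= dotp v e ^+ 2 by rewrite ler_pXn2r// nnegrE ltW.
    lra.
  have h1 : s * `|dotp v g| <= sin a * cos a by rewrite ler_pM.
  have h2 : cos a * sin a <= t * dotp v e by rewrite ler_pM// ltW.
  have h3 : - (s * `|dotp v g|) <= s * dotp v g.
    by rewrite -mulrN ler_wpM2l// lerNl -normrN ler_norm.
  lra.
Qed.

End spherical_volume.

(** * The zone removed by the floating body *)
Section slab.
Variables (R : realType) (n : nat).
Local Notation L := (@lebesgue_rV R n.+1).
Local Notation B := (sqball n.+1 (1 : R)).
Local Notation vec := 'rV[R]_n.+1.
Local Notation mu := (@lebesgue_measure R).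

Lemma integral_deriv_poly (p : {poly R}) (a b : R) : a < b ->
  (\int[mu]_(x in `]a, b[) (p^`().[x])%:E = (p.[b] - p.[a])%:E)%E.
Proof.
move=> ab; have mp (D : set (measurableTypeR R)) :
    measurable_fun D (fun x : measurableTypeR R => (p^`().[x])%:E).
  apply/measurable_EFinP; apply: measurable_funTS; apply: continuous_measurable_fun.
  exact: continuous_horner.
rewrite integral_itv_bndo_bndc; last exact: mp.
rewrite integral_itv_obnd_cbnd; last exact: mp.
rewrite (@continuous_FTC2 _ _ (horner p))//.
- by apply: continuous_subspaceT => x; exact: continuous_horner.
- split; first by move=> x _; exact: derivable_horner.
  + by apply: cvg_at_right_filter; exact: continuous_horner.
  + by apply: cvg_at_left_filter; exact: continuous_horner.
- by move=> x _; rewrite -derivE.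
Qed.

Lemma integral_slab_bound (w K d s : R) : 0 < s ->
  (\int[mu]_(x in `]0%R, s[) (w * (K - (d * x) ^+ n))%:E =
   (w * (K * s - d ^+ n * s ^+ n.+1 / n.+1%:R))%:E)%E.
Proof.
move=> s0; have n0 : n.+1%:R != 0 :> R by rewrite pnatr_eq0.
pose D := d ^+ n / n.+1%:R; have DE : D * n.+1%:R = d ^+ n by rewrite divfK.
pose p : {poly R} := w *: (K *: 'X - D *: 'X^(n.+1)).
have dp (x : R) : (p^`()).[x] = w * (K - (d * x) ^+ n).
  rewrite /p derivZ derivB !derivZ derivX derivXn -scaler_nat !hornerE /=.
  by rewrite exprMn -DE.
transitivity (\int[mu]_(x in `]0%R, s[) (p^`().[x])%:E)%E.
  by apply: eq_integral => x _; rewrite dp.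
rewrite integral_deriv_poly// /p !hornerE /= expr0n /= mulr0 oppr0 mulr0 subr0.
by rewrite /D mulrAC.
Qed.

(** The solid zone of the points whose latitude above the equator normal to [e]
    lies between [0] and the arcsine of [s]. *)
Definition slab (e : vec) (s : R) : set vec :=
  B `&` [set w | 0 <= dotp w e] `&` [set w | dotp w e < s * Num.sqrt (dotp w w)].

Lemma measurable_slab e s : measurable (slab e s).
Proof.
apply: measurableI.
  by apply: measurableI; [exact: measurable_sqball|exact: measurable_dotp_ge0].
apply: measurable_lt_set; first exact: measurable_dotp.
apply: measurable_funM => //; apply: (@measurableT_comp _ _ _ _ _ _ (@Num.sqrt R)).
  apply: continuous_measurable_fun; exact: sqrt_continuous.
exact: measurable_dotp.
Qed.

(** Slicing orthogonally to [e]: at height [x] the slice is the shell between the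
    radii [c / s * x] (the boundary of the cone) and [sqrt (1 - x ^+ 2)] (the
    sphere). For [x <= s] the latter lies between [c] and [1], which
    gives the two bounds. *)
Lemma vol_slab (e : vec) (s : R) : dotp e e = 1 -> 0 < s < 1 ->
  let c := Num.sqrt (1 - s ^+ 2) in
  let w := fine (lebesgue_rV (sqball n (1 : R))) in
  w * (c ^+ n * s - c ^+ n * s / n.+1%:R) <= vol (slab e s) /\
  vol (slab e s) <= w * (s - c ^+ n * s / n.+1%:R).
Proof.
move=> ee /andP[s0 s1] c w.
have s21 : s ^+ 2 < 1 by rewrite expr_lt1// ltW.
have c0 : 0 < c by rewrite sqrtr_gt0 subr_gt0.
have c2 : c ^+ 2 = 1 - s ^+ 2 by rewrite sqr_sqrtr// subr_ge0 ltW.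
have [w0 wf] := sqball1_fin_pos R n; rewrite -/w in w0.
have ee0 : dotp e e = dotp (axis0 R n) (axis0 R n) by rewrite dotp_axis0_self.
pose h x := lebesgue_rV [set y : 'rV[R]_n | slab (axis0 R n) s (vcons x y)].
have slabE : L (slab e s) = (\int[mu]_(x in `]0%R, s[) h x)%E.
  transitivity (L (slab (axis0 R n) s)).
    rewrite -(lebesgue_rV_refl (e - axis0 R n) (measurable_slab (axis0 R n) s)); congr (L _).
    by apply/seteqP; split => v; rewrite /slab /sqball /= dotp_refl_swap// dotp_refl.
  rewrite lebesgue_rVS integral_itv_obnd_cbnd; last first.
    apply: measurable_funTS; exact: measurable_lebesgue_section (measurable_slab _ _).
  rewrite [RHS]integral_mkcond; apply: eq_integral => x _; rewrite /patch mem_setE in_itv /=.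
  case: ifPn => // xs; rewrite (_ : [set y | _] = set0) ?measure0//.
  apply/seteqP; split => // y; rewrite /slab /sqball /= dotp_axis0 vcons0 => -[[v1 x0] xv].
  move: xs; rewrite x0 /= => /negP; apply; apply: (lt_le_trans xv).
  by rewrite ler_piMr ?(ltW s0)// -sqrtr1 ler_wsqrtr.
have hE x : 0 < x < s ->
    h x = (w * (Num.sqrt (1 - x ^+ 2) ^+ n - (c / s * x) ^+ n))%:E.
  move=> /andP[x0 xs].
  have r0 : 0 < c / s * x by rewrite mulr_gt0// divr_gt0.
  have x1 : x ^+ 2 < 1 by rewrite expr_lt1 ?(lt_trans xs)// ltW.
  pose r := (x / s) ^+ 2.
  have xE : x ^+ 2 = r * s ^+ 2 by rewrite /r -exprMn divfK// gt_eqF.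
  have rE : (c / s * x) ^+ 2 = (1 - s ^+ 2) * r.
    by rewrite -c2 /r -exprMn mulrA mulrAC.
  have r1 : r <= 1.
    by rewrite expr_le1 ?divr_ge0 ?(ltW x0) ?(ltW s0)// ler_pdivrMr// mul1r ltW.
  have le : (c / s * x) ^+ 2 <= 1 - x ^+ 2 by rewrite rE xE; lra.
  rewrite /h (_ : [set y | _] = sqball n (1 - x ^+ 2) `\` sqball n ((c / s * x) ^+ 2)); last first.
    have key (y : 'rV[R]_n) :
        (x < s * Num.sqrt (x ^+ 2 + dotp y y)) = ((c / s * x) ^+ 2 < dotp y y :> R).
      have q0 := dotp_ge0 y.
      rewrite -(@ltr_pXn2r _ 2)// ?nnegrE ?(ltW x0) ?mulr_ge0 ?(ltW s0) ?sqrtr_ge0//.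
      rewrite exprMn sqr_sqrtr ?addr_ge0 ?sqr_ge0// rE xE mulrC ltr_pM2l ?exprn_gt0//.
      by apply/idP/idP => H; lra.
    apply/seteqP; split => y; rewrite /slab /sqball /= dotp_vcons dotp_axis0 vcons0 -expr2 key.
      by move=> [[v1 _] v2]; split; [lra|apply/negP; rewrite -ltNge].
    by move=> [v1 /negP]; rewrite -ltNge => v2; split => //; split; [lra|exact: ltW].
  have sv t : 0 < t -> lebesgue_rV (sqball n t) = (Num.sqrt t ^+ n * w)%:E.
    by move=> t0; rewrite sqball_volume// EFinM /w fineK.
  have svx := sv _ (_ : 0 < 1 - x ^+ 2); have svr := sv _ (exprn_gt0 2 r0).
  rewrite measureD; [|exact: measurable_sqball|exact: measurable_sqball|]; last first.
    by rewrite [X in (X < _)%E]svx ?subr_gt0// ltry.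
  rewrite setIidr; last by move=> y /le_trans; apply.
  rewrite [X in (X - _)%E]svx ?subr_gt0// [X in (_ - X)%E]svr -EFinB; congr EFin.
  by rewrite sqrtr_sqr gtr0_norm// -mulrBl mulrC.
have mh : measurable_fun (`]0%R, s[ : set (measurableTypeR R)) h.
  by apply: measurable_funTS; exact: measurable_lebesgue_section (measurable_slab _ _).
have csn : (c / s) ^+ n * s ^+ n.+1 = c ^+ n * s.
  by rewrite exprMn exprVn exprS; field; rewrite expf_neq0 // gt_eqF.
have slabfin : L (slab e s) \is a fin_num.
  by apply: ball_part_fin; [exact: measurable_slab|move=> v [[]]].
have drop_le x : 0 < x < s -> c / s * x <= c.
  by move=> /andP[x0 xs]; rewrite mulrAC ler_pdivrMr// ler_pM2l// ltW.
have mint K : measurable_fun (`]0%R, s[ : set (measurableTypeR R))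
    (fun x => (w * (K - (c / s * x) ^+ n))%:E).
  apply/measurable_EFinP; apply: measurable_funM => //; apply: measurable_funB => //.
  by apply: measurable_funX; exact: measurable_funM.
rewrite -!lee_fin /vol fineK// slabE; split.
- rewrite -[X in _ - X / _]csn -integral_slab_bound//; apply: ge0_le_integral => //.
  + move=> x; rewrite /= in_itv/= => xs; rewrite lee_fin mulr_ge0 ?(ltW w0)// subr_ge0.
    rewrite lerXn2r ?nnegrE ?(ltW c0) ?drop_le//.
    by case/andP: xs => x0 _; rewrite mulr_ge0 ?divr_ge0 ?(ltW c0) ?(ltW s0) ?ltW.
  + move=> x; rewrite /= in_itv/= => xs; rewrite hE// lee_fin ler_pM2l// lerD2r.
    case/andP: xs => x0 xs.
    rewrite lerXn2r ?nnegrE ?sqrtr_ge0// ler_wsqrtr// lerD2l lerN2.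
    by rewrite lerXn2r// ?nnegrE ltW.
- rewrite -[X in X - _]mul1r -[X in _ - X / _]csn -integral_slab_bound//; apply: ge0_le_integral => //.
  + move=> x; rewrite /= in_itv/= => xs; rewrite hE// lee_fin ler_pM2l// lerD2r.
    by rewrite exprn_ile1 ?sqrtr_ge0// -[leRHS]sqrtr1 ler_wsqrtr// gerBl sqr_ge0.
Qed.

End slab.

(** * Gamma values and the limit *)
Section assembly.
Variable R : realType.

(** Combine [GammaE_ball] with the functional equation of the Gamma function; the
    positivity of the right-hand side excludes an infinite or zero Gamma value. *)
Lemma sphere_vol_Gamma m :
  0 < Gamma (m.+1%:R / 2 : R) /\
  sphere_vol R m * Gamma (m.+1%:R / 2) = 2 * Num.sqrt pi ^+ m.+1.
Proof.
have k0 : 0 < m.+1%:R / 2 :> R by rewrite divr_gt0.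
have := GammaE_ball R m.+1; rewrite GammaES//.
have := GammaE_ge0 (m.+1%:R / 2 : R); rewrite GammaEK /sphere_vol /vol.
have p0 : 0 < Num.sqrt (pi : R) ^+ m.+1 by rewrite exprn_gt0// sqrtr_gt0 pi_gt0.
have [w0 wf] := sqball1_fin_pos R m.+1.
rewrite -(fineK wf) /=; move: w0; set w := fine _ => w0.
case: GammaE => [g| |]//.
  rewrite lee_fin -!EFinM /= => g0 /(congr1 fine) /= wg; split; last by rewrite -wg; field.
  rewrite lt_neqAle g0 andbT; apply/eqP => g0'.
  by move: p0; rewrite -wg -g0' !mulr0 ltxx.
by rewrite gt0_muley ?lte_fin// gt0_muley ?lte_fin.
Qed.

Lemma sphere_vol_ratio m :
  2 * pi * sphere_vol R m / sphere_vol R m.+1 =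
  2 * Num.sqrt pi * Gamma (m.+2%:R / 2) / Gamma (m.+1%:R / 2).
Proof.
have [g1 V1] := sphere_vol_Gamma m; have [g2 V2] := sphere_vol_Gamma m.+1.
have p0 : 0 < Num.sqrt (pi : R) by rewrite sqrtr_gt0 pi_gt0.
have pE : (pi : R) = Num.sqrt pi ^+ 2 by rewrite sqr_sqrtr// pi_ge0.
rewrite {1}pE; move: V1 V2 g1 g2 p0; have := sphere_vol_gt0 R m.+1.
move: (sphere_vol R m) (sphere_vol R m.+1).
move: (Gamma (m.+1%:R / 2)) (Gamma (m.+2%:R / 2)) (Num.sqrt pi) => g h p v w w0.
move=> V1 V2 g0 h0 p0.
have -> : v = 2 * p ^+ m.+1 / g by rewrite -V1 mulfK// gt_eqF.
have -> : w = 2 * p ^+ m.+2 / h by rewrite -V2 mulfK// gt_eqF.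
rewrite (exprS p m.+1); field.
by rewrite !gt_eqF// exprn_gt0.
Qed.

(** The difference quotient at [0] of [sin (k * x)]. *)
Lemma cvg_sin_div (k : R) : sin (k * x) / x @[x --> 0^'+] --> k.
Proof.
apply: cvg_dnbhs_at_right.
have [df dE] : is_derive (0 : R) 1 (sin \o (k \*: id)) k.
  apply: is_derive_eq; rewrite /= scaler0 cos0 mul1r.
  by rewrite /GRing.scale /= mulr1.
have -> : (fun x => sin (k * x) / x) =
    (fun h => h^-1 *: (((sin \o (k \*: id)) \o shift 0) (h *: 1) - (sin \o (k \*: id)) 0)).
  apply/funext => x; rewrite /= /shift /GRing.scale /= mulr1 addr0 mulr0 sin0 subr0.
  by rewrite mulrC.
by rewrite -[X in _ --> X]dE; exact: df.
Qed.

Lemma svol_floating_body_defect n (e : 'rV[R]_n.+1) (a : R) : (1 <= n)%N ->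
  dotp e e = 1 -> 0 < a < pi / 2 ->
  fine (svol (halfsphere e)) -
  fine (svol (floating_body (halfsphere e) (a / (2 * pi) * sphere_vol R n))) =
  n.+1%:R * vol (slab e (sin a)).
Proof.
move=> n1 ee a0; rewrite floating_body_halfsphere//.
have sa : 0 < sin a by have pi0 := pi_gt0 R; apply: sin_gt0_pi; apply/andP; split; lra.
pose C := [set v : 'rV[R]_n.+1 | sin a * Num.sqrt (dotp v v) <= dotp v e].
have mC : measurable C.
  apply: measurable_le_set; last exact: measurable_dotp.
  apply: measurable_funM => //; apply: (@measurableT_comp _ _ _ _ _ _ (@Num.sqrt R)).
    apply: continuous_measurable_fun; exact: sqrt_continuous.
  exact: measurable_dotp.
rewrite -/C svol_cone_fin//; last first.
  move=> t v t0; rewrite /C /= !dotpE mulrA -expr2.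
  rewrite sqrtrM ?sqr_ge0// sqrtr_sqr gtr0_norm// mulrCA.
  by rewrite ler_pM2l.
rewrite (_ : halfsphere e = sphere R n `&` [set v | 0 <= dotp v e]); last first.
  by apply/seteqP; split => v /= [].
rewrite svol_cone_fin; last 2 first.
- exact: measurable_dotp_ge0.
- by move=> t v t0 /=; rewrite dotpZl pmulr_rge0.
rewrite -mulrBr; congr (_ * _).
rewrite (_ : sqball n.+1 1 `&` _ = slab e (sin a) `|` (sqball n.+1 1 `&` C)).
  rewrite volU ?addrK//.
  - exact: measurable_slab.
  - by apply: measurableI => //; exact: measurable_sqball.
  - by move=> v [[]].
  - by apply/disj_setPS => v [[_ /=] h1 [_]]; rewrite /C /= leNgt h1.
apply/seteqP; split => v.
  move=> [Bv ve]; have [h|h] := leP (sin a * Num.sqrt (dotp v v)) (dotp v e).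
    by right.
  by left.
move=> [[]//|[Bv Cv]]; split => //; apply: le_trans Cv.
by rewrite mulr_ge0 ?sqrtr_ge0// ltW.
Qed.

End assembly.

Theorem mainTheorem6 (R : realType) (n : nat) (hn : (1 <= n)%N)
    (e : 'rV[R]_n.+1) (he : sphere R n e) :
  (fine (svol (halfsphere e))
     - fine (svol (floating_body (halfsphere e) delta))) / delta
    @[delta --> 0^'+]
    --> 2 * pi * fine (svol (sphere R n.-1)) / fine (svol (sphere R n))
  /\
  2 * pi * fine (svol (sphere R n.-1)) / fine (svol (sphere R n))
    = 2 * Num.sqrt pi * Gamma (n.+1%:R / 2) / Gamma (n%:R / 2).
Proof.
case: n hn e he => // m _ e he.
have ee : dotp e e = 1 := he.
rewrite !svol_sphere; split; last exact: sphere_vol_ratio.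
have pi0 := pi_gt0 R; have V0 := sphere_vol_gt0 R m.+1.
rewrite /=; set V := sphere_vol R m.+1 in V0 *; set k := 2 * pi / V.
have k0 : 0 < k by rewrite divr_gt0// mulr_gt0.
set n := m.+1 in e he ee V V0 k k0 *.
set w := fine (lebesgue_rV (sqball n (1 : R))).
have WE : sphere_vol R m = n%:R * w by [].
have lim_s := @cvg_sin_div R k.
have lim_c : cos (k * x) ^+ n @[x --> (0:R)^'+] --> (1 : R).
  suff : cos (k * x) ^+ n @[x --> (0:R)^'+] --> cos (k * 0) ^+ n.
    by rewrite mulr0 cos0 expr1n.
  apply: cvg_at_right_filter.
  apply: (cvg_comp (fun x => cos (k * x)) (fun y : R => y ^+ n)); last exact: exprn_continuous.
  apply: (cvg_comp (fun x => k * x) cos); last exact: continuous_cos.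
  by apply: cvgM; [exact: cvg_cst|exact: cvg_id].
have limE : 2 * pi * sphere_vol R m / V = k * (n.+1%:R * w * (1 - 1 / n.+1%:R)).
  have aux (p v q : R) : v != 0 -> q + 1 != 0 ->
      2 * p * (q * w) / v = 2 * p / v * ((q + 1) * w * (1 - 1 / (q + 1))).
    by move=> v0 q0; field; rewrite v0 q0.
  by rewrite WE /k -(@natr1 _ n); apply: aux; rewrite ?natr1 ?pnatr_eq0// gt_eqF.
(* The slices of the zone, at heights below sin (k * x), have outer radii between
   cos (k * x) and 1; both bounds have the same limit. *)
pose lo x := sin (k * x) / x *
  (n.+1%:R * w * (cos (k * x) ^+ n - cos (k * x) ^+ n / n.+1%:R)).
pose hi x := sin (k * x) / x *
  (n.+1%:R * w * (1 - cos (k * x) ^+ n / n.+1%:R)).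
rewrite limE; apply: (@squeeze_cvgr _ _ _ _ lo hi).
- near=> x.
  have x0 : 0 < x by near: x; exact: nbhs_right_gt.
  have kx0 : 0 < k * x by rewrite mulr_gt0.
  have kx1 : k * x < pi / 2.
    rewrite mulrC -ltr_pdivlMr//; near: x; apply: nbhs_right_lt.
    by apply: divr_gt0 => //; apply: divr_gt0.
  have kxI : 0 < k * x < pi / 2 by apply/andP.
  have xE : x = k * x / (2 * pi) * V.
    have p0 : 2 * pi != 0 :> R by rewrite gt_eqF// mulr_gt0.
    have kV : k * V = 2 * pi by rewrite /k divfK// gt_eqF.
    have aux (l v p : R) : p != 0 -> l * v = p -> x = l * x / p * v.
      by move=> p1 lv; rewrite -[LHS](mulfK p1) -{1}lv; ring.
    exact: aux kV.
  (* The volume x is cut off at the angle k * x, as [svol_lune] prescribes. *)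
  rewrite [X in floating_body _ X]xE svol_floating_body_defect//.
  have s0 : 0 < sin (k * x) by apply: sin_gt0_pihalf.
  have c0 : 0 < cos (k * x) by apply: cos_gt0_pihalf; rewrite kx1 andbT; lra.
  have cs := cos2Dsin2 (k * x).
  have cE : Num.sqrt (1 - sin (k * x) ^+ 2) = cos (k * x).
    by rewrite -cs addrK sqrtr_sqr gtr0_norm.
  have s1 : sin (k * x) < 1.
    rewrite -(@ltr_pXn2r _ 2)// ?nnegrE ?(ltW s0)// expr1n.
    have c2 : 0 < cos (k * x) ^+ 2 by rewrite exprn_gt0.
    by move: cs; lra.
  have := @vol_slab R n e _ ee (_ : 0 < sin (k * x) < 1).
  rewrite s0 s1 cE -/w => /(_ isT) [lo_le hi_ge].
  have nx0 : 0 < n.+1%:R / x by rewrite divr_gt0.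
  rewrite mulrAC; apply/andP; split.
    rewrite [leLHS](_ : _ = n.+1%:R / x * (w * (cos (k * x) ^+ n * sin (k * x) -
      cos (k * x) ^+ n * sin (k * x) / n.+1%:R))); last by rewrite /lo; ring.
    by rewrite ler_pM2l.
  rewrite [leRHS](_ : _ = n.+1%:R / x * (w * (sin (k * x) -
    cos (k * x) ^+ n * sin (k * x) / n.+1%:R))); last by rewrite /hi; ring.
  by rewrite ler_pM2l.
- apply: cvgM lim_s _; apply: cvgM; first exact: cvg_cst.
  by apply: cvgB => //; apply: cvgM => //; exact: cvg_cst.
- apply: cvgM lim_s _; apply: cvgM; first exact: cvg_cst.
  by apply: cvgB; [exact: cvg_cst|apply: cvgM => //; exact: cvg_cst].
Unshelve. all: by end_near.
Qed.
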